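(* Let $A$ be an alternative Cartan $*$-algebra with $\mathbb{S}_A\ne\varnothing$. Then $\mathcal{N}(A)\le\mathcal{C}(A)$, where $\mathcal{N}(A)$ is the Nash number of $A$ and $\mathcal{C}(A)$ is the Cartan number of $A$.
   Context: **Cartan $*$-algebras.** Let $n\ge 1$, let $\mathcal{P}(n)$ be the power set of $\{1,\dots,n\}$ and $K\triangle H:=(K\setminus H)\cup(H\setminus K)$. A Cartan algebra is a real (not necessarily associative) algebra $A$ with a fixed real vector basis $\{e_K\}_{K\in\mathcal{P}(n)}$ and a function $\sigma:\mathcal{P}(n)\times\mathcal{P}(n)\to\{-1,1\}$ such that $\sigma(K,\varnothing)=\sigma(\varnothing,K)=1$ and $e_Ke_H=\sigma(K,H)e_{K\triangle H}$ for all $K,H$. Thus $e_\varnothing=1$ is the unity, and $\mathbb{R}$ is identified with $\mathbb{R}1\subset A$. $A$ is alternative if $x(xy)=x^2y$ and $(xy)y=xy^2$ for all $x,y$. A $*$-involution is a real linear map $x\mapsto x^c$ with $(x^c)^c=x$, $(xy)^c=y^cx^c$ and $x^c=x$ for $x\in\mathbb{R}$. A Cartan $*$-algebra is a Cartan algebra endowed with a $*$-involution such that $e_{\{k\}}^c\in\{e_{\{k\}},-e_{\{k\}}\}$ for $k=1,\dots,n$. Set $\mathbb{S}_A:=\{J\in A: J^c=-J,\ J^2=-1\}$. **Systems of Cartan pairs.** For $L,M\in\mathcal{P}(n)$, $(e_L,e_M)$ is a Cartan pair if $e_Le_M\in\mathbb{S}_A$ (equivalently $e_{L\triangle M}\in\mathbb{S}_A$).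 For a set $\mathcal{C}$ of pairs $(e_L,e_M)$, put $\mathcal{C}_1:=\{L:\exists M,\ (e_L,e_M)\in\mathcal{C}\}$ and $\mathcal{C}_2:=\{M:\exists L,\ (e_L,e_M)\in\mathcal{C}\}$. $\mathcal{C}$ is a system of Cartan pairs (SCP) of $A$ if all its elements are Cartan pairs, $\mathcal{C}_1\cup\mathcal{C}_2=\mathcal{P}(n)$ and $\mathcal{C}_1\cap\mathcal{C}_2=\varnothing$. The Cartan number is $\mathcal{C}(A):=\min\{\min\{|\mathcal{C}_1|,|\mathcal{C}_2|\}:\mathcal{C}\text{ is a SCP of }A\}$. **Slice regular functions.** For $J\in\mathbb{S}_A$ let $\mathbb{C}_J:=\{\alpha+\beta J:\alpha,\beta\in\mathbb{R}\}$, and let $Q_A:=\bigcup_{J\in\mathbb{S}_A}\mathbb{C}_J$. For $D\subset\mathbb{C}$ non-empty, open and invariant under complex conjugation, let $\Omega_D:=\{\alpha+\beta J:\alpha,\beta\in\mathbb{R},\ \alpha+i\beta\in D,\ J\in\mathbb{S}_A\}\subset Q_A$ (an open circular set). A stem function on $D$ is $F=F_1+\iota F_2:D\to A\otimes_{\mathbb{R}}\mathbb{C}$ ($\iota$ the imaginary unit of the second factor, $F_1,F_2:D\to A$) with $F_1(\bar z)=F_1(z)$, $F_2(\bar z)=-F_2(z)$. It induces the slice function $f=\mathcal{I}(F):\Omega_D\to A$, $f(\alpha+\beta J)=F_1(\alpha+i\beta)+JF_2(\alpha+i\beta)$; $F$ is uniquely determined by $f$. $f$ is slice regular if $F$ is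 of class $C^1$ and $\frac{\partial F}{\partial\alpha}+\iota\frac{\partial F}{\partial\beta}=0$. The real components of $f$ are the functions $f_K:\Omega_D\to\mathbb{R}$ with $f=\sum_K f_Ke_K$. **Nash functions.** Let $k=\mathbb{R}$ or $\mathbb{C}$ and $U\subset k^m$ open. $h:U\to k$ is a $k$-Nash function (real Nash, resp. complex Nash) on $U$ if every point of $U$ has an open neighbourhood $V\subset U$ on which $h$ is $k$-analytic and a non-zero polynomial $P\in k[x_1,\dots,x_m,t]$ with $P(x,h(x))=0$ for all $x\in V$. Identify $A$ with $\mathbb{R}^{\dim A}$ through the basis $\{e_K\}$; a function $g:\Omega\to\mathbb{R}$ on an open circular set $\Omega\subset Q_A$ is a real Nash function on $\Omega$ if every point of $\Omega$ has an open neighbourhood $V$ in $A$ and a real Nash function on $V$ which coincides with $g$ on $V\cap\Omega$. **Slice-Nash functions.** Let $J\in\mathbb{S}_A$; left multiplication makes $A$ a $\mathbb{C}_J$-vector space, of dimension $u_A+1=\dim(A)/2$. If $\{J_0=1,J_1,\dots,J_{u_A}\}$ is a $\mathbb{C}_J$-basis of $A$, the real basis $\{1,J,J_1,JJ_1,\dots,J_{u_A},JJ_{u_A}\}$ is called a splitting basis of $A$ associated to $J$. Given a stem function $F=F_1+\iota F_2$ on $D$, write uniquely $F_s=\sum_{k=0}^{u_A}(F_{s,1}^{J,J_k}+F_{s,2}^{J,J_k}J)J_k$ ($s=1,2$) with $F_{s,\ell}^{J,J_k}:D\to\mathbb{R}$, and set $F^{\ell}_{J,J_k}:=F_{1,\ell}^{J,J_k}+iF_{2,\ell}^{J,J_k}:D\to\mathbb{C}$.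 $F$ is a stem-Nash function on $D$ if there exist $J\in\mathbb{S}_A$ and a splitting basis associated to $J$ such that $F^{\ell}_{J,J_k}$ is a complex Nash function on $D$ for all $\ell\in\{1,2\}$, $k\in\{0,\dots,u_A\}$. $f=\mathcal{I}(F)$ is a slice-Nash function on $\Omega_D$ if $F$ is stem-Nash on $D$. **Nash number.** $\mathcal{N}(A)$ is the minimum integer $\ell$ for which there is a subset $\mathcal{K}\subset\mathcal{P}(n)$ of cardinality $\ell$ such that, for each open circular set $\Omega\subset Q_A$ and each slice regular $f:\Omega\to A$, if $f_K$ is a real Nash function on $\Omega$ for each $K\in\mathcal{K}$, then $f$ is a slice-Nash function. *)

(* Defs.v *)
From HB Require Import structures.
From mathcomp Require Import all_boot all_order all_algebra.
From mathcomp Require Import all_classical all_reals all_analysis.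
From mathcomp Require Import complex.
From mathcomp Require mpoly.
(* The notations of mpoly clash with those of all_analysis. *)
Import -(notations) mpoly.
Import Order.TTheory GRing.Theory Num.Theory.
Import numFieldNormedType.Exports.

Set Implicit Arguments.
Unset Strict Implicit.
Unset Printing Implicit Defensive.

Local Open Scope classical_set_scope.
Local Open Scope complex_scope.
Local Open Scope ring_scope.

(* {1,...,n} is represented by 'I_n and the power set P(n) by {set 'I_n}. *)
Definition setsymdiff (n : nat) (K H : {set 'I_n}) : {set 'I_n} :=
  ((K :\: H) :|: (H :\: K))%SET.

Record cartan_algebra (R : realType) (n : nat) := CartanAlgebra {
  ca_vect :> vectType R;
  ca_mul : ca_vect -> ca_vect -> ca_vect;
  ca_mul_linearl : forall y, linear (ca_mul ^~ y);
  ca_mul_linearr : forall x, linear (ca_mul x);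
  ca_e : {set 'I_n} -> ca_vect;
  ca_e_basis : basis_of fullv (codom ca_e);
  ca_sigma : {set 'I_n} -> {set 'I_n} -> R;
  ca_sigma_pm1 : forall K H, ca_sigma K H = - 1 \/ ca_sigma K H = 1;
  ca_sigma0r : forall K, ca_sigma K finset.set0 = 1;
  ca_sigma0l : forall K, ca_sigma finset.set0 K = 1;
  ca_mul_e : forall K H,
    ca_mul (ca_e K) (ca_e H) = ca_sigma K H *: ca_e (setsymdiff K H)
}.

Definition ca_one (R : realType) (n : nat) (A : cartan_algebra R n) : A :=
  ca_e A finset.set0.

Record cartan_star_algebra (R : realType) (n : nat) := CartanStarAlgebra {
  csa_algebra :> cartan_algebra R n;
  csa_conj : csa_algebra -> csa_algebra;
  csa_conj_linear : linear csa_conj;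
  csa_conjK : forall x, csa_conj (csa_conj x) = x;
  csa_conjM : forall x y,
    csa_conj (ca_mul x y) = ca_mul (csa_conj y) (csa_conj x);
  csa_conj_real : forall a : R,
    csa_conj (a *: ca_one csa_algebra) = a *: ca_one csa_algebra;
  csa_conj_e : forall k : 'I_n,
    csa_conj (ca_e csa_algebra [set k]%SET) = ca_e csa_algebra [set k]%SET \/
    csa_conj (ca_e csa_algebra [set k]%SET) = - ca_e csa_algebra [set k]%SET
}.

Definition is_minimum (S : set nat) (m : nat) : Prop :=
  S m /\ forall k, S k -> (m <= k)%N.

Section Nash.
Variable K : numFieldType.

(* h is the sum, near a, of a power series in x - a converging absolutely on
   a polydisc; the multi-indices of total degree < d form the finite type
   mpoly.bmultinom m d. *)
Definition analytic_at (m : nat) (h : 'rV[K]_m -> K) (a : 'rV[K]_m) : Prop :=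
  exists (c : mpoly.multinom m -> K) (r : K),
    [/\ 0 < r,
        cvgn (fun d : nat => \sum_(nu : mpoly.bmultinom m d)
                `|c nu| * r ^+ mpoly.mdeg nu)
      & forall x : 'rV[K]_m, (forall i, `|x 0 i - a 0 i| < r) ->
          (fun d : nat => \sum_(nu : mpoly.bmultinom m d)
             c nu * \prod_(i < m) (x 0 i - a 0 i) ^+ mpoly.fun_of_multinom nu i)
          @ \oo --> h x].

(* The values of h outside U are irrelevant; the last variable of P is t. *)
Definition nash_on (m : nat) (U : set 'rV[K]_m) (h : 'rV[K]_m -> K) : Prop :=
  forall x, U x -> exists V : set 'rV[K]_m,
    [/\ open V, V x, V `<=` U,
        forall y, V y -> analytic_at h y
      & exists2 P : mpoly.mpoly (m + 1) K, P != 0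
        & forall y, V y ->
            mpoly.meval (fun i => row_mx y (h y)%:M 0 i) P = 0].

End Nash.

Section ComplexPlane.
Variable R : realType.

(* The numFieldType structure of R[i] carries its topology. *)
Definition Cplx : numFieldType := R[i].

Definition complex_nash_on (D : set Cplx) (g : Cplx -> Cplx) : Prop :=
  nash_on [set x : 'rV[Cplx]_1 | D (x 0 0)] (fun x => g (x 0 0)).

Definition circular_domain (D : set Cplx) : Prop :=
  [/\ D !=set0, open D & forall z : R[i], D z -> D (conjc z)].

Definition real_line (u : Cplx -> R) (z : R[i]) : R -> R :=
  fun a => u (a +i* complex.Im z).
Definition imag_line (u : Cplx -> R) (z : R[i]) : R -> R :=
  fun b => u (complex.Re z +i* b).

Definition d_alpha (u : Cplx -> R) (z : Cplx) : R :=
  derive1 (real_line u z) (complex.Re z).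
Definition d_beta (u : Cplx -> R) (z : Cplx) : R :=
  derive1 (imag_line u z) (complex.Im z).

Definition C1_on (D : set Cplx) (u : Cplx -> R) : Prop :=
  forall z : Cplx, D z ->
    [/\ derivable (real_line u z) (complex.Re z) 1,
        derivable (imag_line u z) (complex.Im z) 1,
        {for z, continuous (d_alpha u)}
      & {for z, continuous (d_beta u)}].

End ComplexPlane.

Section CartanStarAlgebra.
Variables (R : realType) (n : nat) (A : cartan_star_algebra R n).

Local Notation C := (Cplx R).
Local Notation "x ** y" := (ca_mul x y) (at level 40, left associativity).

Definition alternative : Prop :=
  forall x y : A, x ** (x ** y) = (x ** x) ** y /\ (x ** y) ** y = x ** (y ** y).

Definition imaginary_units : set A :=
  [set J : A | csa_conj J = - J /\ J ** J = - ca_one A].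

Definition cartan_pair (p : {set 'I_n} * {set 'I_n}) : Prop :=
  imaginary_units (ca_e A p.1 ** ca_e A p.2).

(* The pair (e_L, e_M) is encoded by (L, M). *)
Definition is_SCP (S : {set {set 'I_n} * {set 'I_n}}) : Prop :=
  [/\ forall p, p \in S -> cartan_pair p,
      ([set p.1 | p in S] :|: [set p.2 | p in S] = [set: {set 'I_n}])%SET
    & ([set p.1 | p in S] :&: [set p.2 | p in S] = finset.set0)%SET].

Definition is_cartan_number (c : nat) : Prop :=
  is_minimum [set k : nat | exists2 S, is_SCP S
    & k = minn #|[set p.1 | p in S]%SET| #|[set p.2 | p in S]%SET| ] c.

Definition coords (x : A) : 'rV[R]_#|{set 'I_n}| :=
  \row_i coord (codom_tuple (ca_e A)) i x.

Definition component (K : {set 'I_n}) (x : A) : R := coords x 0 (enum_rank K).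

(* alpha + beta J, for z = alpha + i beta. *)
Definition slice_embed (J : A) (z : R[i]) : A :=
  complex.Re z *: ca_one A + complex.Im z *: J.

Definition Omega (D : set C) : set A :=
  [set x : A | exists (J : A) (z : C),
     [/\ imaginary_units J, D z & x = slice_embed J z]].

(* A function F : D -> A (x) C is given by the pair (F1, F2) such that
   F = F1 + iota F2. *)
Definition stem (D : set C) (F1 F2 : C -> A) : Prop :=
  forall z : R[i], D z -> F1 (conjc z) = F1 z /\ F2 (conjc z) = - F2 z.

Definition induces (D : set C) (F1 F2 : C -> A) (f : A -> A) : Prop :=
  forall (J : A) (z : C), imaginary_units J -> D z ->
    f (slice_embed J z) = F1 z + J ** F2 z.

Definition D_alpha (F : C -> A) (z : C) : A :=
  \sum_(K : {set 'I_n}) d_alpha (component K \o F) z *: ca_e A K.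
Definition D_beta (F : C -> A) (z : C) : A :=
  \sum_(K : {set 'I_n}) d_beta (component K \o F) z *: ca_e A K.

(* dF/dalpha + iota dF/dbeta = 0 split into its two A-valued parts. *)
Definition slice_regular (D : set C) (f : A -> A) : Prop :=
  exists F1 F2 : C -> A,
    [/\ stem D F1 F2, induces D F1 F2 f,
        forall K : {set 'I_n},
          C1_on D (component K \o F1) /\ C1_on D (component K \o F2)
      & forall z, D z ->
          D_alpha F1 z - D_beta F2 z = 0 /\ D_alpha F2 z + D_beta F1 z = 0].

Definition real_nash_on (O : set A) (g : A -> R) : Prop :=
  forall x, O x -> exists (V : set 'rV[R]_#|{set 'I_n}|)
                          (h : 'rV[R]_#|{set 'I_n}| -> R),
    [/\ open V, V (coords x), nash_on V h
      & forall y, O y -> V (coords y) -> h (coords y) = g y].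

Definition uA : nat := (\dim (fullv : {vspace A}))./2.-1.

(* slice_embed J w ** x is the scalar action of w in C_J on x. *)
Definition splitting_basis (J : A) (B : 'I_uA.+1 -> A) : Prop :=
  B ord0 = ca_one A /\
  forall x : A, exists! w : {ffun 'I_uA.+1 -> R[i]},
    x = \sum_(k < uA.+1) slice_embed J (w k) ** B k.

(* w s k z = F_{s,1}^{J,J_k}(z) + i F_{s,2}^{J,J_k}(z). *)
Definition stem_nash (D : set C) (F1 F2 : C -> A) : Prop :=
  exists (J : A) (B : 'I_uA.+1 -> A) (w1 w2 : 'I_uA.+1 -> C -> R[i]),
    [/\ imaginary_units J,
        splitting_basis J B,
        forall z, D z ->
          F1 z = \sum_(k < uA.+1) slice_embed J (w1 k z) ** B k /\
          F2 z = \sum_(k < uA.+1) slice_embed J (w2 k z) ** B k,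
        forall k, complex_nash_on D
          (fun z => (complex.Re (w1 k z) +i* complex.Re (w2 k z) : R[i]))
      & forall k, complex_nash_on D
          (fun z => (complex.Im (w1 k z) +i* complex.Im (w2 k z) : R[i]))].

(* The stem function of f is unique on D when S_A is not empty, so the
   existential quantifier selects it. *)
Definition slice_nash (D : set C) (f : A -> A) : Prop :=
  exists F1 F2 : C -> A,
    [/\ stem D F1 F2, induces D F1 F2 f & stem_nash D F1 F2].

Definition nash_determining (T : {set {set 'I_n}}) : Prop :=
  forall (D : set C) (f : A -> A), circular_domain D -> slice_regular D f ->
    (forall K, K \in T -> real_nash_on (Omega D) (fun x => component K (f x))) ->
    slice_nash D f.

Definition is_nash_number (l : nat) : Prop :=
  is_minimum [set k : nat | exists2 T, nash_determining T & k = #|T| ] l.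

End CartanStarAlgebra.

(* Main.v *)
Require Import Defs.
From mathcomp Require Import all_boot all_order all_algebra.
From mathcomp Require Import all_classical all_reals all_analysis.
From HB Require Import structures.
From mathcomp Require Import ring lra zify.
From mathcomp Require Import complex.
From mathcomp Require mpoly.
Import -(notations) mpoly.
Import Order.TTheory GRing.Theory Num.Theory.
Import numFieldNormedType.Exports.

Set Implicit Arguments.
Unset Strict Implicit.
Unset Printing Implicit Defensive.

Local Open Scope classical_set_scope.
Local Open Scope complex_scope.
Local Open Scope ring_scope.

(** Why the theorem is true.

    Some basis vector e_K is an imaginary unit: if J is one, the coefficient of 1 in
    J J = -1 is the sum of the a_K^2 sigma(K,K), over the K with e_K^c = -e_K, so one of these
    sigma(K,K) is -1 ([exists_basis_unit]).  Pairing L with its symmetric difference with K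
    gives a system of Cartan pairs, so the Cartan number exists, and it remains to see that
    each side of a system of Cartan pairs determines the slice-Nash property
    ([SCP_determining]).

    Let (e_L, e_M) be a Cartan pair, so that e_K is an imaginary unit for K the symmetric
    difference of L and M, and let f be slice regular with stem function F1 + iota F2.  Write
    F_H = component_H F1 + i component_H F2.  On the slice of J = e_K the L-th component of f
    at alpha + beta J is u = component_L F1 + s component_M F2, with s = sigma(K,M) a sign:
    it is the real part of the holomorphic function Phi = F_L - i s F_M.  With
    Phi*(z) the conjugate of Phi at the conjugate of z, the symmetry of the stem function gives
    Phi* = F_L + i s F_M.  So if u is real Nash, it suffices to show that Phi is complex Nash
    and that sums of complex Nash functions are complex Nash: then one component of f controls
    both F_L and F_M ([nash_component_germs]), and a side of the system controls every F_H.
    Finally J together with the e_H, for H in a set of representatives modulo K, is a splitting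
    basis whose coordinates are the F_H up to sign ([splitting_basis_rep]).

    The analytic statement is that v is determined by u.  Since u has a convergent Taylor
    series, its Taylor polynomials approximate it together with its first derivatives;
    integrating the Cauchy-Riemann equations along the two sides of a rectangle and comparing
    the results degree by degree shows that each homogeneous part of u is harmonic, hence the
    real part of some w_d z^d, and that Phi is the sum of the w_d z^d
    ([conj_path_independent], [holomorphic_power_series]).

    For the algebraic statement, a polynomial relation for the Nash function on the space of all
    components may become trivial on the plane of the slice; dividing by a power of the
    transversal parameter before restricting repairs this ([reduce_to_plane]) and yields
    Q(x, y, u(x,y)) = 0 with Q nonzero.  Put
      H(z,w) = Q((z+w)/2, (z-w)/(2i), (Phi(z) + conj(Phi(conj w)))/2).
    This is a finite sum of products A(z) B(w) of analytic functions that vanishes for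
    w = conj z, so it vanishes for independent z and w ([polarization]).  Fixing w leaves a
    polynomial relation between z and Phi(z), and it is nontrivial for some w
    ([holomorphic_algebraic]).

    Sums of algebraic functions are algebraic because sums of integral elements are integral,
    over the polynomials acting on a ring of functions ([algebraic_linear]). *)

(** * Power series, homogeneous forms and their uniqueness *)

Section PowerSeries.
Variable K : numFieldType.
Implicit Types (a b f : nat -> K) (c : nat -> nat -> K) (A B : K -> K) (H : K -> K -> K).

(** The homogeneous form of degree [d] whose coefficient at x^(d-k) y^k is [c d k]: a
    double power series is grouped by total degree throughout. *)
Definition binary_form c d (x y : K) : K := \sum_(k < d.+1) c d k * (x ^+ (d - k) * y ^+ k).
Definition taylor_sum a n (z : K) : K := \sum_(k < n) a k * z ^+ k.

(** A quantitative form of: A is the sum, on the disc of radius [rho], of a power series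
    that converges absolutely on the closed disc.  The geometric decay of the remainders is
    what makes the notion stable under products without reordering of double series. *)
Definition power_series (rho : K) A a M : Prop :=
  (forall n, \sum_(k < n) `|a k| * rho ^+ k <= M) /\
  forall n tau z, `|z| < tau -> tau <= rho ->
    `|A z - taylor_sum a n z| <= M * (tau / rho) ^+ n.

(** The same remainder estimate in two variables, the partial sums being taken by total
    degree. *)
Definition power_series2 (rho : K) H c M : Prop :=
  forall n tau z w, `|z| < tau -> `|w| < tau -> tau <= rho ->
    `|H z w - \sum_(d < n) binary_form c d z w| <= M * (tau / rho) ^+ n.

Lemma sum_triangle (u v : nat -> K) n :
  \sum_(d < n) \sum_(k < d.+1) u (d - k)%N * v k
  = \sum_(j < n) u j * \sum_(k < n - j) v k.
Proof.
elim: n => [|n IH]; first by rewrite !big_ord0.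
rewrite big_ord_recr /= IH [RHS]big_ord_recr /= subSnn big_ord1.
have -> : \sum_(k < n.+1) u (n - k)%N * v k =
   \sum_(j < n) u j * v (n - j)%N + u n * v 0%N.
  rewrite (reindex_inj rev_ord_inj) /= big_ord_recr /= subSS subnn subn0; congr (_ + _).
  by apply: eq_bigr => i _; rewrite subSS subKn // ltnW // ltnW.
rewrite addrA -big_split /=; congr (_ + _); apply: eq_bigr => j _.
by rewrite subSn ?(ltnW (ltn_ord j)) // big_ord_recr /= mulrDr.
Qed.

Lemma power_series_ge0 rho A a M : power_series rho A a M -> 0 <= M.
Proof. by case=> /(_ 0%N); rewrite big_ord0. Qed.

Lemma power_series_bound rho A a M z :
  0 < rho -> power_series rho A a M -> `|z| < rho -> `|A z| <= M.
Proof.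
move=> r0 [_ /(_ 0%N rho z)] h zr; have := h zr (lexx _).
by rewrite /taylor_sum big_ord0 subr0 expr0 mulr1.
Qed.

(** The product A(z) B(w) differs from its Taylor polynomial of total degree below n by
    (A - A_n) B plus the sum of the a_j z^j (B - B_(n-j)); each term is of order (tau/rho)^n. *)
Lemma power_series2_prod rho A a M B b N : 0 < rho ->
  power_series rho A a M -> power_series rho B b N ->
  power_series2 rho (fun z w => A z * B w) (fun d k => a (d - k)%N * b k) (2 * M * N).
Proof.
move=> r0 hA hB n tau z w zt wt tr.
have t0 : 0 < tau by apply: le_lt_trans zt.
have q0 : 0 <= tau / rho by rewrite divr_ge0 // ltW.
have -> : \sum_(d < n) binary_form (fun d k => a (d - k)%N * b k) d z w
    = \sum_(j < n) (a j * z ^+ j) * taylor_sum b (n - j) w.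
  rewrite -(sum_triangle (fun j => a j * z ^+ j) (fun k => b k * w ^+ k)).
  by apply: eq_bigr => d _; apply: eq_bigr => k _; ring.
have -> : A z * B w - \sum_(j < n) (a j * z ^+ j) * taylor_sum b (n - j) w =
  (A z - taylor_sum a n z) * B w + \sum_(j < n) (a j * z ^+ j) * (B w - taylor_sum b (n - j) w).
  rewrite mulrBl (mulr_suml _ _ _ (B w)) -addrA; congr (_ + _).
  rewrite addrC -sumrB -sumrN; apply: eq_bigr => j _; ring.
apply: le_trans (ler_normD _ _) _.
have M0 := power_series_ge0 hA; have N0 := power_series_ge0 hB.
have -> : 2 * M * N * (tau / rho) ^+ n =
  M * (tau / rho) ^+ n * N + M * (N * (tau / rho) ^+ n) by ring.
apply: lerD.
  rewrite normrM; apply: ler_pM => //; first exact: hA.2.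
  by apply: power_series_bound hB _; rewrite // (lt_le_trans wt).
apply: le_trans (ler_norm_sum _ _ _) _.
apply: (@le_trans _ _ (\sum_(j < n) (`|a j| * rho ^+ j) * (N * (tau / rho) ^+ n))); last first.
  rewrite -mulr_suml ler_wpM2r // ?mulr_ge0 ?exprn_ge0 //; exact: hA.1.
apply: ler_sum => j _; rewrite normrM.
have -> : `|a j| * rho ^+ j * (N * (tau / rho) ^+ n) =
  (`|a j| * tau ^+ j) * (N * (tau / rho) ^+ (n - j)).
  have -> : (tau / rho) ^+ n = (tau / rho) ^+ j * (tau / rho) ^+ (n - j).
    by rewrite -exprD subnKC // ltnW.
  by rewrite [in LHS]expr_div_n; field; rewrite expf_neq0 // gt_eqF.
apply: ler_pM => //; last exact: hB.2.
rewrite normrM ler_wpM2l // normrX lerXn2r // ?nnegrE ?normr_ge0 // ltW //.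
Qed.

(** The Cauchy product is the restriction of the two-variable product to the diagonal. *)
Lemma power_series_mul rho A a M B b N : 0 < rho ->
  power_series rho A a M -> power_series rho B b N ->
  power_series rho (fun z => A z * B z)
    (fun d => \sum_(k < d.+1) a (d - k)%N * b k) (2 * M * N).
Proof.
move=> r0 hA hB; have M0 := power_series_ge0 hA; have N0 := power_series_ge0 hB.
split=> [n|n tau z zt tr].
  apply: (@le_trans _ _ (\sum_(d < n) \sum_(k < d.+1)
      (`|a (d - k)%N| * rho ^+ (d - k)) * (`|b k| * rho ^+ k))).
    apply: ler_sum => d _; rewrite mulrC -ler_pdivlMl ?exprn_gt0 //.
    apply: le_trans (ler_norm_sum _ _ _) _; rewrite mulr_sumr.
    apply: ler_sum => k _; rewrite normrM.
    have -> : `|a (d - k)%N| * rho ^+ (d - k) * (`|b k| * rho ^+ k) =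
      `|a (d - k)%N| * `|b k| * rho ^+ d.
      have -> : rho ^+ d = rho ^+ (d - k) * rho ^+ k by rewrite -exprD subnK // -ltnS.
      by ring.
    by rewrite mulrCA mulVf ?mulr1 // expf_neq0 // gt_eqF.
  rewrite (sum_triangle (fun j => `|a j| * rho ^+ j) (fun k => `|b k| * rho ^+ k)).
  apply: (@le_trans _ _ (M * N)); last first.
    by rewrite -mulrA [2 * _]mulr_natl mulr2n lerDl mulr_ge0.
  apply: (@le_trans _ _ (\sum_(j < n) `|a j| * rho ^+ j * N)).
    apply: ler_sum => j _; apply: ler_wpM2l; last exact: hB.1.
    by rewrite mulr_ge0 // exprn_ge0 // ltW.
  rewrite -mulr_suml; apply: ler_wpM2r => //; exact: hA.1.
have := power_series2_prod r0 hA hB n zt zt tr.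
congr (`|_ - _| <= _); apply: eq_bigr => d _; rewrite /binary_form mulr_suml.
by apply: eq_bigr => k _; rewrite -exprD subnK // -ltnS.
Qed.

Lemma power_series_add rho A a M B b N : 0 < rho ->
  power_series rho A a M -> power_series rho B b N ->
  power_series rho (fun z => A z + B z) (fun k => a k + b k) (M + N).
Proof.
move=> r0 hA hB; split=> [n|n tau z zt tr].
  apply: le_trans (lerD (hA.1 n) (hB.1 n)); rewrite -big_split /=.
  by apply: ler_sum => k _; rewrite -mulrDl ler_wpM2r ?ler_normD // exprn_ge0 // ltW.
have -> : A z + B z - taylor_sum (fun k => a k + b k) n z =
  (A z - taylor_sum a n z) + (B z - taylor_sum b n z).
  rewrite addrACA -opprD /taylor_sum -big_split /=; congr (_ - _).
  by apply: eq_bigr => k _; rewrite mulrDl.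
rewrite mulrDl; apply: le_trans (ler_normD _ _) _; apply: lerD.
  exact: hA.2.
exact: hB.2.
Qed.

Lemma power_series_scale rho e A a M :
  power_series rho A a M ->
  power_series rho (fun z => e * A z) (fun k => e * a k) (`|e| * M).
Proof.
move=> hA; split=> [n|n tau z zt tr].
  rewrite (eq_bigr (fun k : 'I_n => `|e| * (`|a k| * rho ^+ k))).
    by rewrite -mulr_sumr ler_wpM2l //; apply: hA.1.
  by move=> k _; rewrite normrM mulrA.
have -> : e * A z - taylor_sum (fun k => e * a k) n z = e * (A z - taylor_sum a n z).
  rewrite mulrBr /taylor_sum mulr_sumr; congr (_ - _).
  by apply: eq_bigr => k _; rewrite mulrA.
by rewrite normrM -mulrA ler_wpM2l //; apply: hA.2.
Qed.

Lemma power_series_const rho e : 0 < rho ->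
  power_series rho (fun=> e) (fun k => if k == 0%N then e else 0) `|e|.
Proof.
have S (g : nat -> K) n : \sum_(k < n.+1) (if k == 0%N :> nat then e else 0) * g k = e * g 0%N.
  rewrite big_ord_recl /= big1 ?addr0 // => i _; by rewrite mul0r.
move=> r0; split=> [[|n]|[|n] tau z zt tr].
- by rewrite big_ord0.
- rewrite big_ord_recl big1 /= ?expr0 ?mulr1 ?addr0 // => i _; by rewrite normr0 mul0r.
- by rewrite /taylor_sum big_ord0 subr0 expr0 mulr1.
rewrite /taylor_sum (S (fun k => z ^+ k)) expr0 mulr1 subrr normr0 mulr_ge0 // exprn_ge0 //.
by rewrite divr_ge0 ?(ltW r0) // ltW // (le_lt_trans _ zt).
Qed.

Lemma power_series_id rho : 0 < rho ->
  power_series rho id (fun k => (k == 1%N)%:R) rho.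
Proof.
move=> r0.
have S n z : taylor_sum (fun k => (k == 1%N)%:R) n.+2 z = z.
  rewrite /taylor_sum 2!big_ord_recl /= mul0r add0r mul1r expr1 big1 ?addr0 //.
  by move=> i _; rewrite mul0r.
split=> [n|n tau z zt tr].
  rewrite (eq_bigr (fun k : 'I_n => (k == 1%N :> nat)%:R * rho ^+ k)); last first.
    by move=> k _; rewrite normr_nat.
  have := S n.-2 rho; rewrite /taylor_sum; case: n => [|[|n /= ->]] // _.
    by rewrite big_ord0 ltW.
  by rewrite big_ord1 mul0r ltW.
have t0 : 0 < tau by apply: le_lt_trans zt.
case: n => [|[|n]]; last by rewrite S subrr normr0 mulr_ge0 ?exprn_ge0 ?divr_ge0 ?ltW.
  by rewrite /taylor_sum big_ord0 subr0 mulr1 (le_trans (ltW zt)).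
rewrite /taylor_sum big_ord1 mul0r subr0 expr1 mulrCA divff ?gt_eqF // mulr1; exact: ltW.
Qed.

(** Asymptotic uniqueness: the lowest nonzero term t^d f_d would dominate as t tends to 0.
    Applied to Taylor polynomials along rays, this isolates their homogeneous parts, with no
    differentiation. *)
Lemma homogeneous_vanish (f : nat -> K) (M t0 : K) n :
  0 < t0 -> t0 <= 1 -> 0 <= M ->
  (forall t, 0 < t -> t <= t0 -> `|\sum_(d < n) t ^+ d * f d| <= M * t ^+ n) ->
  forall d, (d < n)%N -> f d = 0.
Proof.
move=> p0 p1 M0 h; elim/ltn_ind => d IH dn.
apply/eqP; rewrite -normr_eq0; apply: contraT => fd0.
have fp : 0 < `|f d| by rewrite lt0r fd0 normr_ge0.
pose C := M + \sum_(e < n) `|f e|.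
have C0 : 0 <= C by rewrite addr_ge0 // sumr_ge0.
(* So small that t C < |f d|, while the dominant term forces |f d| <= t C. *)
pose t := t0 * (`|f d| / (`|f d| + C)).
have D0 : 0 < `|f d| + C by rewrite ltr_wpDr.
have tp : 0 < t by rewrite mulr_gt0 ?divr_gt0.
have tt0 : t <= t0 by rewrite ler_piMr ?(ltW p0) // ler_pdivrMr // mul1r lerDl.
have t1 : t <= 1 by apply: le_trans p1.
have key : `|f d| <= t * C.
  have := h t tp tt0.
  rewrite (bigD1 (Ordinal dn)) //= => hh.
  have tail : `|\sum_(i < n | i != Ordinal dn) t ^+ i * f i| <= t ^+ d.+1 * \sum_(e < n) `|f e|.
    apply: le_trans (ler_norm_sum _ _ _) _.
    rewrite mulr_sumr [leRHS](bigID (fun i => i != Ordinal dn)) /=.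
    rewrite -[leLHS]addr0; apply: lerD; last first.
      by apply: sumr_ge0 => i _; apply: mulr_ge0 => //; apply/exprn_ge0/ltW.
    apply: ler_sum => i ni; have [lt|ge] := ltnP i d.
      by rewrite (IH i) // mulr0 !normr0 mulr0.
    rewrite normrM ler_wpM2r // ger0_norm; last exact/exprn_ge0/ltW.
    apply: ler_wiXn2l => //; [exact: ltW | rewrite ltn_neqAle ge andbT].
    by apply: contraNneq ni => e; apply/eqP/val_inj.
  have : `|t ^+ d * f d| <= t ^+ d.+1 * C.
    rewrite -[t ^+ d * f d](addrK (\sum_(i < n | i != Ordinal dn) t ^+ i * f i)).
    apply: le_trans (ler_normB _ _) _; rewrite mulrDr; apply: lerD => //.
    apply: le_trans hh _; rewrite mulrC ler_wpM2r //.
    apply: ler_wiXn2l => //; exact: ltW.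
  rewrite normrM (ger0_norm (exprn_ge0 _ (ltW tp))) exprSr -mulrA ler_pM2l ?exprn_gt0 //.
have : t * C < `|f d|.
  apply: (@le_lt_trans _ _ (`|f d| / (`|f d| + C) * C)).
    by rewrite ler_wpM2r // ler_piMl // divr_ge0 // ltW.
  by rewrite mulrAC ltr_pdivrMr // [ltRHS]mulrDr ltrDr mulr_gt0. 
by move/(le_lt_trans key); rewrite ltxx.
Qed.

Lemma binary_form_scale c d t x y : binary_form c d (t * x) (t * y) = t ^+ d * binary_form c d x y.
Proof.
rewrite /binary_form mulr_sumr; apply: eq_bigr => k _; rewrite !exprMn.
have -> : t ^+ d = t ^+ (d - k) * t ^+ k by rewrite -exprD subnK // -ltnS.
by ring.
Qed.

Lemma poly_vanish (p : {poly K}) (s : nat -> K) : injective s ->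
  (forall i, p.[s i] = 0) -> p = 0.
Proof.
move=> sI h; apply/eqP; apply: contraT => pn0.
suff /(max_poly_roots pn0) : all (root p) (map s (iota 0 (size p))).
  by rewrite map_inj_uniq ?iota_uniq // size_map size_iota ltnn => /(_ isT).
by apply/allP => _ /mapP[i _ ->]; apply/eqP.
Qed.

(** A form is dehomogenized to a polynomial in one variable, which cannot have infinitely
    many roots. *)
Lemma binary_form_vanish c d (s : nat -> K) : injective s ->
  (forall i, binary_form c d 1 (s i) = 0) -> forall k, (k <= d)%N -> c d k = 0.
Proof.
move=> sI h k kd; pose p := \poly_(k < d.+1) c d k.
suff p0 : p = 0 by have := coef_poly d.+1 (c d) k; rewrite -/p p0 coef0 ltnS kd.
apply: (poly_vanish sI) => i.
rewrite horner_poly -[RHS](h i); apply: eq_bigr => j _.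
by rewrite expr1n mul1r.
Qed.

End PowerSeries.

(** * Polarization on the complex plane *)

Section Polarization.
Local Open Scope complex_scope.
Variable R : realType.
Local Notation C := R[i].

(** The archimedean property, for complex numbers in the role of bounds. *)
Lemma le_geometric_eq0 (x : C) (M : C) :
  (forall n, `|x| <= M * (1 / 2) ^+ n) -> x = 0.
Proof.
move=> h; apply/eqP; rewrite -normr_eq0; apply: contraT => x0.
have xp : 0 < `|x| by rewrite lt0r x0 normr_ge0.
have H n : n%:R <= M / `|x|.
  apply: (@le_trans _ _ (2 ^+ n)); first by rewrite -natrX ler_nat ltnW // ltn_expl.
  rewrite ler_pdivlMr // mulrC -ler_pdivlMr ?exprn_gt0 //.
  by have := h n; rewrite expr_div_n expr1n mul1r.
have := H (Num.bound (complex.Re (M / `|x|))).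
rewrite lecE => /andP[_].
rewrite (_ : complex.Re _%:R = (Num.bound (complex.Re (M / `|x|)))%:R); last first.
  by rewrite raddfMn.
rewrite leNgt archimedean.Num.Theory.archi_boundP //.
by have := H 0%N; rewrite lecE => /andP[_].
Qed.

Lemma conjcM (x y : C) : conjc (x * y) = conjc x * conjc y.
Proof. exact: rmorphM. Qed.

Lemma conjcX (x : C) n : conjc (x ^+ n) = conjc x ^+ n.
Proof. exact: rmorphXn. Qed.

Lemma conj_pos (t : C) : 0 < t -> conjc t = t.
Proof. case: t => a b; rewrite ltcE /= => /andP[/eqP -> _]; by rewrite oppr0. Qed.

Lemma Cayley_denom (k : nat) : 1 + 'i * k%:R != 0 :> C.
Proof.
apply/eqP => /(congr1 (@complex.Re R)).
rewrite -[k%:R](rmorph_nat (real_complex R)) /= !(mul0r, mulr0) subr0 addr0.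
by move/eqP; rewrite oner_eq0.
Qed.

(** These are quotients of the conjugate of 1 + ik by 1 + ik; they provide infinitely many ratios
    of conj z to z, enough to separate the monomials z^j (conj z)^k of one degree. *)
Lemma Cayley_inj : injective (fun k : nat => (1 - 'i * k%:R) / (1 + 'i * k%:R) : C).
Proof.
move=> k l /= /eqP; rewrite eqr_div ?Cayley_denom // => /eqP e.
have e2 : 2 * 'i%C * (l%:R - k%:R) = 0 :> C.
  have -> : 2 * 'i%C * (l%:R - k%:R) =
    (1 - 'i%C * k%:R) * (1 + 'i%C * l%:R) - (1 - 'i%C * l%:R) * (1 + 'i%C * k%:R) :> C by ring.
  by rewrite e subrr.
move/eqP: e2; rewrite !mulf_eq0 pnatr_eq0 /= subr_eq0 eqr_nat eq_complex /= oner_eq0 andbF /=.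
by move/eqP.
Qed.

(** The set w = conj z is totally real in the space of pairs (z,w), so a function analytic in both
    variables is determined by its restriction to it.  Homogeneous part by homogeneous part,
    the restriction is a form in z and conj z that vanishes at every z, hence has zero
    coefficients. *)
Lemma polarization (rho : C) H c M : 0 < rho -> power_series2 rho H c M ->
  (forall z, `|z| < rho -> H z (conjc z) = 0) ->
  forall z w, `|z| < rho / 2 -> `|w| < rho / 2 -> H z w = 0.
Proof.
move=> r0 hH h0.
have M0 : 0 <= M.
  by have := hH 0%N rho 0 0; rewrite normr0 expr0 mulr1 => /(_ r0 r0 (lexx _)); apply: le_trans.
have hz d (ze : C) : binary_form c d ze (conjc ze) = 0.
  have np : 0 < 1 + `|ze| by rewrite ltr_wpDr.
  have rp : 0 < 1 + rho by rewrite addr_gt0.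
  (* For t <= t0 the point t ze stays in the disc of radius rho. *)
  pose t0 := rho / ((1 + rho) * (1 + `|ze|)).
  apply: (@homogeneous_vanish _ (fun d => binary_form c d ze (conjc ze)) (M * ((1 + `|ze|) / rho) ^+ d.+1) t0 d.+1) => //.
  - by rewrite divr_gt0 ?mulr_gt0.
  - rewrite ler_pdivrMr ?mulr_gt0 // mul1r (@le_trans _ _ (1 + rho)) ?lerDr //.
    by rewrite ler_peMr ?(ltW rp) // lerDl.
  - by rewrite mulr_ge0 ?exprn_ge0 // divr_ge0 ?ltW.
  move=> t tp tt.
  have tau : `|t * ze| < t * (1 + `|ze|).
    by rewrite normrM gtr0_norm // ltr_pM2l // ltrDr.
  have taur : t * (1 + `|ze|) <= rho.
    rewrite -ler_pdivlMr //; apply: le_trans tt _; rewrite /t0 invfM mulrA.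
    by rewrite ler_wpM2r ?invr_ge0 ?(ltW np) // ler_pdivrMr // ler_peMr ?(ltW r0) // lerDl ltW.
  have tau' : `|t * (conjc ze)| < t * (1 + `|ze|).
    by move: tau; rewrite !normrM normcJ.
  have := hH d.+1 _ _ _ tau tau' taur.
  have -> : H (t * ze) (t * (conjc ze)) = 0.
    by rewrite -[X in X * (conjc ze)](conj_pos tp) -conjcM h0 // (lt_le_trans tau).
  rewrite sub0r normrN.
  under eq_bigr do rewrite binary_form_scale.
  suff -> : M * ((1 + `|ze|) / rho) ^+ d.+1 * t ^+ d.+1 =
    M * (t * (1 + `|ze|) / rho) ^+ d.+1 by [].
  by rewrite -mulrA -exprMn; congr (_ * _ ^+ _); ring.
have c0 d k : (k <= d)%N -> c d k = 0.
  apply: (binary_form_vanish Cayley_inj) => i; set ze := 1 + 'i%C * i%:R.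
  have -> : 1 - 'i%C * i%:R = (conjc ze) :> C.
    rewrite /ze -[i%:R](rmorph_nat (real_complex R)); apply/eqP.
    by rewrite eq_complex /= !(mul0r, mulr0, mul1r, subr0, addr0, add0r, oppr0) !eqxx.
  have zn0 : ze != 0 := Cayley_denom i.
  have e : binary_form c d ze (conjc ze) = binary_form c d (ze * 1) (ze * (conjc ze / ze)).
    by rewrite mulr1 mulrC divfK.
  have := hz d ze; rewrite e binary_form_scale.
  by move/eqP; rewrite mulf_eq0 expf_eq0 (negbTE zn0) andbF => /eqP.
move=> z w zr wr; apply: (@le_geometric_eq0 _ M) => n.
have rr : rho / 2 <= rho by rewrite ler_pdivrMr // ler_peMr ?(ltW r0) // ler1n.
have := hH n _ _ _ zr wr rr.
rewrite big1 => [|d _]; last by rewrite /binary_form big1 // => k _; rewrite c0 ?mul0r // -ltnS.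
by rewrite subr0 mul1r [_ / 2 / _]mulrAC divff ?gt_eqF // mul1r.
Qed.
End Polarization.

(** * Real power series in two variables and conjugate harmonic functions *)

Section Real.
Variable R : realType.

Lemma cvg_norm_le (s : nat -> R) (l B : R) n :
  s @ \oo --> l -> (forall N, (n <= N)%N -> `|s N| <= B) -> `|l| <= B.
Proof.
move=> sl h; have sl' : (fun N => `|s N|) @ \oo --> `|l| by apply: cvg_norm.
by apply: (cvgr_to_le sl'); exists n => // N /= nN; apply: h.
Qed.

(** A local Lipschitz constant bounds the derivative: this turns the Lipschitz estimate on the
    remainder of a Taylor series into an estimate on its partial derivatives, so no termwise
    differentiation of the series is needed. *)
Lemma lipschitz_derive (g : R -> R) (x p e L : R) : 0 < e ->
  is_derive x 1 g p -> (forall h, `|h| < e -> `|g (x + h) - g x| <= L * `|h|) -> `|p| <= L.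
Proof.
move=> e0 [dg <-] H.
have hc : (fun h => `|h^-1 *: (g (h *: 1 + x) - g x)|) @ 0^' --> `|'D_1 g x|.
  by apply: cvg_norm; exact: dg.
apply: (cvgr_to_le hc).
have : \forall h \near (0:R)^', `|h| < e by exact: dnbhs0_lt.
have : \forall h \near (0:R)^', h != 0 by exact: nbhs_dnbhs_neq.
apply: filterS2 => h hn0 he.
have -> : h *: 1 + x = x + h by rewrite [h *: 1]mulr1 addrC.
by rewrite normrM normfV ler_pdivrMl ?normr_gt0 // [leRHS]mulrC; apply: H.
Qed.

Lemma mean_value_bound (g g' : R -> R) (tau L Y : R) :
  (forall t : R, `|t| < tau -> is_derive t 1 g (g' t)) ->
  (forall t : R, `|t| < tau -> `|g' t| <= L) -> `|Y| < tau ->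
  `|g Y - g 0| <= L * `|Y|.
Proof.
move=> dg bg Yt.
have key (a b : R) : a <= b -> `|a| < tau -> `|b| < tau -> `|g b - g a| <= L * (b - a).
  move=> ab at_ bt.
  have inn t : t \in `[a, b] -> `|t| < tau.
    rewrite in_itv /= => /andP[at1 tb]; move: at_ bt; rewrite !ltr_norml.
    by move=> /andP[h1 _] /andP[_ h2]; rewrite (lt_le_trans h1 at1) (le_lt_trans tb h2).
  have [||c cab ->] := @MVT_segment R g g' a b ab.
  - by move=> t tab; apply/dg/inn; apply: subset_itv_oo_cc tab.
  - by apply: derivable_within_continuous => t /inn /dg [].
  rewrite normrM (ger0_norm (_ : 0 <= b - a)) ?subr_ge0 // ler_wpM2r ?subr_ge0 //.
  by apply/bg/inn.
have t0 : `|0 : R| < tau by rewrite normr0 (le_lt_trans _ Yt).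
have [Y0|Y0] := leP 0 Y.
  by rewrite (ger0_norm Y0) -{2}[Y]subr0; apply: key.
by rewrite distrC (ltr0_norm Y0) -[- Y]add0r; apply: key => //; apply: ltW.
Qed.

Lemma monomial_lipschitz (x x' tau de : R) j :
  `|x| <= tau -> `|x'| <= tau -> `|x - x'| <= de ->
  tau * `|x ^+ j - x' ^+ j| <= j%:R * tau ^+ j * de.
Proof.
move=> xt xt' xd; have t0 : 0 <= tau by apply: le_trans xt.
elim: j => [|j IH]; first by rewrite subrr normr0 mulr0 !mul0r.
have -> : x ^+ j.+1 - x' ^+ j.+1 = x * (x ^+ j - x' ^+ j) + (x - x') * x' ^+ j.
  by rewrite !exprS; ring.
apply: (@le_trans _ _ (tau * (tau * `|x ^+ j - x' ^+ j|) + tau * (de * tau ^+ j))).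
  rewrite -mulrDr ler_wpM2l //; apply: le_trans (ler_normD _ _) _.
  rewrite !normrM normrX; apply: lerD; first by rewrite ler_wpM2r.
  by apply: ler_pM => //; rewrite ?exprn_ge0 // lerXn2r.
apply: (@le_trans _ _ (tau * (j%:R * tau ^+ j * de) + tau * (de * tau ^+ j))).
  by rewrite lerD2r ler_wpM2l.
by rewrite le_eqVlt; apply/orP; left; apply/eqP; rewrite exprS -[j.+1%:R]natr1; ring.
Qed.

Lemma monomial2_lipschitz (x x' y y' tau de : R) j k :
  `|x| <= tau -> `|x'| <= tau -> `|y| <= tau -> `|y'| <= tau ->
  `|x - x'| <= de -> `|y - y'| <= de ->
  tau * `|x ^+ j * y ^+ k - x' ^+ j * y' ^+ k| <= (j + k)%:R * tau ^+ (j + k) * de.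
Proof.
move=> xt xt' yt yt' xd yd; have t0 : 0 <= tau by apply: le_trans xt.
have -> : x ^+ j * y ^+ k - x' ^+ j * y' ^+ k =
  (x ^+ j - x' ^+ j) * y ^+ k + x' ^+ j * (y ^+ k - y' ^+ k) by ring.
apply: (@le_trans _ _ ((j%:R * tau ^+ j * de) * tau ^+ k + tau ^+ j * (k%:R * tau ^+ k * de))).
  apply: le_trans (ler_wpM2l t0 (ler_normD _ _)) _; rewrite !normrM mulrDr; apply: lerD.
    rewrite mulrA; apply: ler_pM; rewrite ?mulr_ge0 ?monomial_lipschitz //.
    by rewrite normrX lerXn2r.
  rewrite mulrCA; apply: ler_pM; rewrite ?mulr_ge0 ?monomial_lipschitz //.
  by rewrite normrX lerXn2r.
by rewrite le_eqVlt; apply/orP; left; apply/eqP; rewrite natrD exprD; ring.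
Qed.

(** Absolute convergence is stated on the square of half-side [r], the sup norm being convenient
    for moving along horizontal and vertical segments. *)
Definition real_series (r M : R) (c : nat -> nat -> R) (u : R -> R -> R) : Prop :=
  (forall n, \sum_(d < n) (\sum_(k < d.+1) `|c d k|) * r ^+ d <= M) /\
  forall x y, `|x| < r -> `|y| < r ->
    (fun n => \sum_(d < n) binary_form c d x y) @ \oo --> u x y.

Lemma binary_form_lipschitz c d (x x' y y' tau de : R) :
  `|x| <= tau -> `|x'| <= tau -> `|y| <= tau -> `|y'| <= tau ->
  `|x - x'| <= de -> `|y - y'| <= de ->
  tau * `|binary_form c d x y - binary_form c d x' y'| <=
    (\sum_(k < d.+1) `|c d k|) * (d%:R * tau ^+ d * de).
Proof.
move=> xt xt' yt yt' xd yd; have t0 : 0 <= tau by apply: le_trans xt.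
rewrite /binary_form -sumrB mulr_suml; apply: le_trans (ler_wpM2l t0 (ler_norm_sum _ _ _)) _.
rewrite mulr_sumr; apply: ler_sum => k _.
rewrite -mulrBr normrM mulrCA ler_wpM2l //.
have e : (d - k + k = d)%N by rewrite subnK -1?ltnS //.
by have := monomial2_lipschitz (d - k) k xt xt' yt yt' xd yd; rewrite e.
Qed.

Section Analytic.
Variables (r M : R) (c : nat -> nat -> R) (u : R -> R -> R).
Hypotheses (r0 : 0 < r) (hu : real_series r M c u).
Let rho := r / 2.

Lemma half_radius_gt0 : 0 < rho. Proof. by rewrite /rho divr_gt0. Qed.
Lemma half_radius_lt : rho < r. Proof. by rewrite /rho ltr_pdivrMr // ltr_pMr // ltr1n. Qed.

(** A monomial of degree d has Lipschitz constant d tau^(d-1) on the square of half-side tau;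
    the factor d is absorbed by halving the radius, as d is at most 2^d. *)
Lemma remainder_lipschitz n x x' y y' (tau de : R) :
  0 < tau -> tau <= rho ->
  `|x| <= tau -> `|x'| <= tau -> `|y| <= tau -> `|y'| <= tau ->
  `|x - x'| <= de -> `|y - y'| <= de ->
  `|(u x y - \sum_(d < n) binary_form c d x y) - (u x' y' - \sum_(d < n) binary_form c d x' y')|
     <= M / tau * (tau / rho) ^+ n * de.
Proof.
move=> t0 tr xt xt' yt yt' xd yd.
have tr' : tau < r := le_lt_trans tr half_radius_lt.
have de0 : 0 <= de := le_trans (normr_ge0 _) xd.
have q0 : 0 <= tau / rho by rewrite divr_ge0 ?(ltW t0) ?(ltW half_radius_gt0).
have q1 : tau / rho <= 1 by rewrite ler_pdivrMr ?half_radius_gt0 // mul1r.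
pose s N := (\sum_(d < N) binary_form c d x y - \sum_(d < n) binary_form c d x y)
   - (\sum_(d < N) binary_form c d x' y' - \sum_(d < n) binary_form c d x' y').
apply: (@cvg_norm_le s _ _ n).
  apply: cvgB; (apply: cvgB; [apply: hu.2; exact: le_lt_trans tr'|exact: cvg_cst]).
move=> N nN.
have -> : s N = \sum_(n <= d < N) (binary_form c d x y - binary_form c d x' y').
  rewrite /s -!(big_mkord xpredT (binary_form c ^~ _ ^~ _)) sumrB.
  rewrite (big_cat_nat _ nN) //= [in X in _ - (X - _)](big_cat_nat _ nN) //=; ring.
rewrite -(ler_pM2l t0).
have -> : tau * (M / tau * (tau / rho) ^+ n * de) = M * ((tau / rho) ^+ n * de).
  by field; rewrite !gt_eqF ?half_radius_gt0.
apply: le_trans (ler_wpM2l (ltW t0) (ler_norm_sum _ _ _)) _; rewrite mulr_sumr.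
apply: (@le_trans _ _ (\sum_(n <= d < N) (\sum_(k < d.+1) `|c d k|) * r ^+ d * ((tau / rho) ^+ n * de))).
  rewrite big_nat [leRHS]big_nat; apply: ler_sum => d /andP[nd _].
  apply: le_trans (binary_form_lipschitz _ _ xt xt' yt yt' xd yd) _.
  rewrite -[leRHS]mulrA ler_wpM2l ?sumr_ge0 // mulrA ler_wpM2r //.
  have -> : d%:R * tau ^+ d = r ^+ d * ((d%:R / 2 ^+ d) * (tau / rho) ^+ d).
    rewrite /rho !expr_div_n -mulrA; field.
    by rewrite !expf_neq0 ?gt_eqF // half_radius_gt0.
  rewrite ler_wpM2l ?exprn_ge0 ?(ltW r0) //.
  apply: (@le_trans _ _ (1 * (tau / rho) ^+ d)).
    rewrite ler_wpM2r ?exprn_ge0 // ler_pdivrMr ?exprn_gt0 // mul1r -natrX ler_nat.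
    by rewrite ltnW // ltn_expl.
  by rewrite mul1r ler_wiXn2l.
rewrite -mulr_suml ler_wpM2r ?mulr_ge0 ?exprn_ge0 //; apply: le_trans (hu.1 N).
rewrite -(big_mkord xpredT (fun d => (\sum_(k < d.+1) `|c d k|) * r ^+ d)).
rewrite [leRHS](big_cat_nat _ nN) //= lerDr; apply: sumr_ge0 => d _.
by rewrite mulr_ge0 ?sumr_ge0 // exprn_ge0 // ltW.
Qed.

Definition form_polyX d y : {poly R} := \sum_(k < d.+1) (c d k * y ^+ k) *: 'X^(d - k).
Definition form_polyY d x : {poly R} := \sum_(k < d.+1) (c d k * x ^+ (d - k)) *: 'X^(k : nat).
(** The primitive in y, vanishing at y = 0, of the x-derivative of the form of degree [d]: the
    contribution of the vertical side of a rectangle to the harmonic conjugate. *)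
Definition conj_polyY d x : {poly R} :=
  \sum_(k < d.+1) (c d k * (d - k)%:R / k.+1%:R * x ^+ (d - k).-1) *: 'X^(k.+1).
(** The primitive in x, vanishing at x = 0, of minus the y-derivative of the form of degree
    [d]: the contribution of the horizontal side. *)
Definition conj_polyX d y : {poly R} :=
  - \sum_(k < d.+1) (c d k * k%:R / (d - k).+1%:R * y ^+ k.-1) *: 'X^((d - k).+1).

Lemma deriv_sum n (F : 'I_n -> {poly R}) :
  (\sum_(i < n) F i)^`() = \sum_(i < n) (F i)^`().
Proof. exact: raddf_sum. Qed.

Lemma form_polyXE d x y : (form_polyX d y).[x] = binary_form c d x y.
Proof.
by rewrite horner_sum; apply: eq_bigr => k _; rewrite hornerZ hornerXn; ring.
Qed.
Lemma form_polyYE d x y : (form_polyY d x).[y] = binary_form c d x y.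
Proof.
by rewrite horner_sum; apply: eq_bigr => k _; rewrite hornerZ hornerXn; ring.
Qed.

Lemma deriv_conj_polyY d x y : (conj_polyY d x)^`().[y] = (form_polyX d y)^`().[x].
Proof.
rewrite !deriv_sum !horner_sum; apply: eq_bigr => k _.
rewrite !derivZ !derivXn /= !hornerZ !hornerMn !hornerXn -![_ ^+ _ *+ _]mulr_natr.
have : (k.+1%:R : R) != 0 by rewrite pnatr_eq0.
set a := k.+1%:R; move: (c d k) (_%:R) (x ^+ _) (y ^+ _) a => ? ? ? ? ? n0; by field; exact: n0.
Qed.

Lemma deriv_conj_polyX d x y : (conj_polyX d y)^`().[x] = - (form_polyY d x)^`().[y].
Proof.
rewrite derivN hornerN !deriv_sum !horner_sum; congr (- _); apply: eq_bigr => k _.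
rewrite !derivZ !derivXn /= !hornerZ !hornerMn !hornerXn -![_ ^+ _ *+ _]mulr_natr.
have : ((d - k).+1%:R : R) != 0 by rewrite pnatr_eq0.
set a := (d - k).+1%:R; move: (c d k) (_%:R) (x ^+ _) (y ^+ _) a => ? ? ? ? ? n0; by field; exact: n0.
Qed.

Lemma conj_polyY0 d x : (conj_polyY d x).[0] = 0.
Proof.
by rewrite horner_sum big1 // => k _; rewrite !hornerE exprS mul0r mulr0.
Qed.
Lemma conj_polyX0 d y : (conj_polyX d y).[0] = 0.
Proof.
by rewrite hornerN horner_sum big1 ?oppr0 // => k _; rewrite !hornerE exprS mul0r mulr0.
Qed.

Lemma conj_polyY_scale d t x y : (conj_polyY d (t * x)).[t * y] = t ^+ d * (conj_polyY d x).[y].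
Proof.
rewrite !horner_sum mulr_sumr; apply: eq_bigr => k _; rewrite !hornerZ !hornerXn /= !exprMn.
have [->|kd] := eqVneq (d - k)%N 0%N; first by rewrite /= !(mulr0n, mulr0, mul0r).
have -> : t ^+ d = t ^+ (d - k).-1 * t ^+ k.+1.
  by rewrite -exprD addnS -addSn prednK ?lt0n // subnK -1?ltnS //.
by ring.
Qed.

Lemma conj_polyX_scale d t x y : (conj_polyX d (t * y)).[t * x] = t ^+ d * (conj_polyX d y).[x].
Proof.
rewrite !hornerN mulrN !horner_sum mulr_sumr; congr (- _).
apply: eq_bigr => k _; rewrite !hornerZ !hornerXn /= !exprMn.
have [->|kd] := eqVneq (k : nat) 0%N; first by rewrite /= !(mulr0n, mulr0, mul0r).
have -> : t ^+ d = t ^+ k.-1 * t ^+ (d - k).+1.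
  by rewrite -exprD addnS -addSn prednK ?lt0n // subnKC -1?ltnS //.
by ring.
Qed.

Lemma horner_sumE n (F : nat -> {poly R}) (g : nat -> R) x :
  (forall d, (F d).[x] = g d) -> (\sum_(d < n) F d).[x] = \sum_(d < n) g d.
Proof. by move=> e; rewrite horner_sum; apply: eq_bigr => d _; apply: e. Qed.

Lemma deriv_sumE n (F : nat -> {poly R}) (g : nat -> R) x :
  (forall d, (F d)^`().[x] = g d) -> (\sum_(d < n) F d)^`().[x] = \sum_(d < n) g d.
Proof. by move=> e; rewrite deriv_sum (horner_sumE n e). Qed.

Variables v p q : R -> R -> R.
Hypothesis CR : forall x y : R, `|x| < r -> `|y| < r ->
  [/\ is_derive x 1 (u^~ y) (p x y), is_derive y 1 (u x) (q x y),
      is_derive y 1 (v x) (p x y) & is_derive x 1 (v^~ y) (- q x y)].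

(** The Taylor polynomials of u approximate its partial derivatives to one order less. *)
Lemma derive_remainder n x y tau : `|x| < tau -> `|y| < tau -> tau <= rho ->
  `|p x y - \sum_(d < n) (form_polyX d y)^`().[x]| <= M / tau * (tau / rho) ^+ n /\
  `|q x y - \sum_(d < n) (form_polyY d x)^`().[y]| <= M / tau * (tau / rho) ^+ n.
Proof.
move=> xt yt tr; have t0 : 0 < tau by apply: le_lt_trans xt.
have tr' : tau < r := le_lt_trans tr half_radius_lt.
have near0 (z h : R) : `|h| < tau - `|z| -> `|z + h| <= tau.
  by move=> hz; rewrite (le_trans (ler_normD _ _)) // addrC -lerBrDr ltW.
have [du dv _ _] := CR (lt_trans xt tr') (lt_trans yt tr').
split.
  apply: (@lipschitz_derive (fun x => u x y - (\sum_(d < n) form_polyX d y).[x]) x _ (tau - `|x|)).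
  - by rewrite subr_gt0.
  - by have := is_deriveB du (is_derive_poly (\sum_(d < n) form_polyX d y) x);
      rewrite deriv_sum horner_sum.
  move=> h hx; rewrite !(horner_sumE n (fun d => form_polyXE d _ _)).
  apply: remainder_lipschitz => //; rewrite ?near0 ?(ltW xt) ?(ltW yt) ?subrr ?normr0 //.
  by rewrite addrAC subrr add0r.
apply: (@lipschitz_derive (fun y => u x y - (\sum_(d < n) form_polyY d x).[y]) y _ (tau - `|y|)).
- by rewrite subr_gt0.
- by have := is_deriveB dv (is_derive_poly (\sum_(d < n) form_polyY d x) y);
    rewrite deriv_sum horner_sum.
move=> h hx; rewrite !(horner_sumE n (fun d => form_polyYE d _ _)).
apply: remainder_lipschitz => //; rewrite ?near0 ?(ltW xt) ?(ltW yt) ?subrr ?normr0 //.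
by rewrite addrAC subrr add0r.
Qed.

(** The increment of the conjugate function v along a vertical or a horizontal segment is read off from
    the Taylor polynomial of u, by the Cauchy-Riemann equations and the mean value theorem. *)
Lemma conj_remainder n x y tau : `|x| < tau -> `|y| < tau -> tau <= rho ->
  `|v x y - v x 0 - \sum_(d < n) (conj_polyY d x).[y]| <= M * (tau / rho) ^+ n /\
  `|v x y - v 0 y - \sum_(d < n) (conj_polyX d y).[x]| <= M * (tau / rho) ^+ n.
Proof.
move=> xt yt tr; have t0 : 0 < tau by apply: le_lt_trans xt.
have tr' : tau < r := le_lt_trans tr half_radius_lt.
have M0 : 0 <= M by have := hu.1 0%N; rewrite big_ord0.
have q0 : 0 <= M / tau * (tau / rho) ^+ n.
  by rewrite mulr_ge0 ?exprn_ge0 // divr_ge0 // ltW // half_radius_gt0.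
have shrink (z : R) : `|z| < tau -> M / tau * (tau / rho) ^+ n * `|z| <= M * (tau / rho) ^+ n.
  move=> zt; apply: le_trans (ler_wpM2l q0 (ltW zt)) _.
  by rewrite mulrAC divfK // gt_eqF.
split.
  apply: le_trans (shrink _ yt).
  pose g t := v x t - (\sum_(d < n) conj_polyY d x).[t].
  have -> : v x y - v x 0 - \sum_(d < n) (conj_polyY d x).[y] = g y - g 0.
    rewrite /g (horner_sumE n (fun d => conj_polyY0 d _)) big1_eq subr0 horner_sum.
    by rewrite addrAC.
  apply: (@mean_value_bound g (fun t => p x t - \sum_(d < n) (form_polyX d t)^`().[x]) tau) => // t tt.
    have [_ _ dv _] := CR (lt_trans xt tr') (lt_trans tt tr').
    have := is_deriveB dv (is_derive_poly (\sum_(d < n) conj_polyY d x) t).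
    by rewrite (deriv_sumE n (fun d => deriv_conj_polyY d _ _)).
  by have [] := derive_remainder n xt tt tr.
apply: le_trans (shrink _ xt).
pose g t := v t y - (\sum_(d < n) conj_polyX d y).[t].
have -> : v x y - v 0 y - \sum_(d < n) (conj_polyX d y).[x] = g x - g 0.
  rewrite /g (horner_sumE n (fun d => conj_polyX0 d _)) big1_eq subr0 horner_sum.
  by rewrite addrAC.
apply: (@mean_value_bound g (fun t => - (q t y - \sum_(d < n) (form_polyY d t)^`().[y])) tau) => // t tt.
  have [_ _ _ dv] := CR (lt_trans tt tr') (lt_trans yt tr').
  apply: is_derive_eq (is_deriveB dv (is_derive_poly (\sum_(d < n) conj_polyX d y) t)) _.
  by rewrite (deriv_sumE n (fun d => deriv_conj_polyX d _ _)) [\sum_(d < n) - _]sumrN opprK opprB addrC.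
by rewrite normrN; have [] := derive_remainder n tt yt tr.
Qed.

(** Both paths from (0,0) to (x,y) along the sides of the rectangle give the increment of v, up to
    an error of order d+1; the parts of degree d must then agree exactly.  This is the
    harmonicity of the form of degree d in integrated form. *)
Lemma conj_path_independent d x y :
  (conj_polyY d x).[y] + (conj_polyX d 0).[x] = (conj_polyX d y).[x] + (conj_polyY d 0).[y].
Proof.
apply/eqP; rewrite -subr_eq0; apply/eqP.
pose f d := (conj_polyY d x).[y] + (conj_polyX d 0).[x] - ((conj_polyX d y).[x] + (conj_polyY d 0).[y]).
pose w := 1 + `|x| + `|y|.
have wp : 0 < w by rewrite /w -addrA ltr_wpDr ?addr_ge0.
have xw : `|x| < w by rewrite /w; have := normr_ge0 y; lra.
have yw : `|y| < w by rewrite /w; have := normr_ge0 x; lra.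
have M0 : 0 <= M by have := hu.1 0%N; rewrite big_ord0.
have rp := half_radius_gt0.
have q0 : 0 <= w / rho by rewrite divr_ge0 ?(ltW wp) ?(ltW rp).
apply: (@homogeneous_vanish _ f (4 * M * (w / rho) ^+ d.+1) (Num.min 1 (rho / w)) d.+1) => //.
- by rewrite lt_min ltr01 divr_gt0.
- by rewrite ge_min lexx.
- by rewrite !mulr_ge0 ?exprn_ge0.
move=> t tp; rewrite le_min => /andP[_ tw].
have tr : t * w <= rho by rewrite -ler_pdivlMr.
have xt : `|t * x| < t * w by rewrite normrM gtr0_norm // ltr_pM2l.
have yt : `|t * y| < t * w by rewrite normrM gtr0_norm // ltr_pM2l.
have zt : `|0 : R| < t * w by rewrite normr0 mulr_gt0.
have [a1 a2] := conj_remainder d.+1 xt yt tr.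
have [_ a3] := conj_remainder d.+1 xt zt tr.
have [a4 _] := conj_remainder d.+1 zt yt tr.
have -> : \sum_(e < d.+1) t ^+ e * f e =
  \sum_(e < d.+1) (conj_polyY e (t * x)).[t * y] + \sum_(e < d.+1) (conj_polyX e 0).[t * x]
  - (\sum_(e < d.+1) (conj_polyX e (t * y)).[t * x] + \sum_(e < d.+1) (conj_polyY e 0).[t * y]).
  rewrite -!big_split -sumrB /=; apply: eq_bigr => e _; rewrite /f.
  have e1 := conj_polyX_scale e t x 0; have e2 := conj_polyY_scale e t 0 y.
  rewrite mulr0 in e1 e2; rewrite e1 e2 conj_polyY_scale conj_polyX_scale; ring.
have -> : 4 * M * (w / rho) ^+ d.+1 * t ^+ d.+1 = 4 * (M * (t * w / rho) ^+ d.+1).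
  by rewrite -!mulrA -exprMn; congr (_ * (_ * _ ^+ _)); ring.
move: a1 a2 a3 a4; rewrite !ler_norml; set S1 := \sum_(_ < _) _.
set S2 := \sum_(_ < _) _; set S3 := \sum_(_ < _) _; set S4 := \sum_(_ < _) _.
by move=> /andP[? ?] /andP[? ?] /andP[? ?] /andP[? ?]; apply/andP; split; lra.
Qed.
End Analytic.
End Real.

(** * Real parts with a convergent Taylor series force holomorphy in the power series sense *)

Section Holo.
Variable R : realType.

(** Path independence, at x = 1, is an identity of polynomials in y; its coefficient of
    degree k+1 is the recurrence that expresses a vanishing Laplacian. *)
Lemma harmonic_coef (c : nat -> nat -> R) d k :
  (forall x y, (conj_polyY c d x).[y] + (conj_polyX c d 0).[x] = (conj_polyX c d y).[x] + (conj_polyY c d 0).[y]) ->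
  (k.+2 <= d)%N ->
  c d k.+2 * (k.+1%:R * k.+2%:R) = - c d k * ((d - k)%:R * (d - k.+1)%:R).
Proof.
move=> H kd.
pose a j := c d j * (d - j)%:R / j.+1%:R * (1 - 0 ^+ (d - j).-1).
pose b j := c d j * j%:R / (d - j).+1%:R * (1 - 0 ^+ j.-1).
pose G : {poly R} := \sum_(j < d.+1) a j *: 'X^(j.+1) + \sum_(j < d.+1) b j *: 'X^(j.-1).
have G0 : G = 0.
  apply: (@poly_vanish _ _ (fun i => i%:R)); first by move=> i j /eqP; rewrite eqr_nat => /eqP.
  move=> i; have := H 1 i%:R; move/eqP; rewrite -subr_eq0 => /eqP <-.
  have -> : conj_polyY c d 1 = \sum_(j < d.+1) (a j *: 'X^(j.+1)) + conj_polyY c d 0.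
    rewrite -big_split /=; apply: eq_bigr => j _; rewrite -scalerDl /a expr1n.
    by congr (_ *: _); ring.
  have -> : (conj_polyX c d i%:R).[1] = (conj_polyX c d 0).[1] - (\sum_(j < d.+1) b j *: 'X^(j.-1)).[i%:R].
    rewrite !hornerN !horner_sum -opprD -big_split /=; congr (- _); apply: eq_bigr => j _.
    rewrite !hornerZ !hornerXn !expr1n /b !mulr1; move: (c d j * _ / _) => K.
    by case: (j : nat).-1 => [|l]; rewrite ?expr0 1?[0 ^+ _]exprS ?mul0r; ring.
  by rewrite !hornerD; ring.
have := congr1 (fun p : {poly R} => p`_(k.+1)) G0.
rewrite /= coef0 coefD !coef_sum.
rewrite (bigD1 (Ordinal (ltnW (ltnW kd : k < d)%N : k < d.+1)%N)) //= big1 => [|j jk]; last first.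
  rewrite coefZ coefXn eqSS; case: eqP => e; last by rewrite mulr0.
  by case/eqP: jk; apply/val_inj.
rewrite (bigD1 (Ordinal (kd : k.+2 < d.+1)%N)) //= big1 => [|j jk]; last first.
  rewrite coefZ coefXn; case: eqP => e; last by rewrite mulr0.
  by case/eqP: jk; apply/val_inj => /=; lia.
rewrite !coefZ !coefXn !eqxx !mulr1 !addr0 /a /b.
have -> : (d - k).-1 = (d - k.+2).+1 by rewrite -subnS -subnSK.
rewrite [0 ^+ k.+1]expr0n [0 ^+ _.+1]expr0n /= !subr0 !mulr1.
have -> : (d - k.+2).+1 = (d - k.+1)%N by rewrite subnSK.
have n1 : (k.+1%:R : R) != 0 by rewrite pnatr_eq0.
have n2 : ((d - k.+1)%:R : R) != 0 by rewrite pnatr_eq0 -lt0n subn_gt0.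
move: (c d k) (c d k.+2) (k.+1%:R : R) (k.+2%:R : R) ((d - k)%:R : R) ((d - k.+1)%:R : R) n1 n2.
move=> c0 c2 k1 k2 dk dk1 n1 n2 e; apply/eqP; rewrite mulNr -addr_eq0; apply/eqP.
have -> : c2 * (k1 * k2) + c0 * (dk * dk1) = (c0 * dk / k1 + c2 * k2 / dk1) * (k1 * dk1).
  by field; rewrite n1 n2.
by rewrite e mul0r.
Qed.

(** The complex number w for which the form of degree [d] is the real part of w (x+iy)^d: the
    coefficients of x^d and of x^(d-1) y determine it.  In degree 0 its imaginary part is 0. *)
Definition holomorphic_coef (c : nat -> nat -> R) d : R[i] := c d 0%N +i* (- (c d 1%N / d%:R)).

(** The recurrence has step 2, so a harmonic form is determined by its first two coefficients;
    binomial coefficients times the real part of w i^k satisfy the same recurrence. *)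
Lemma harmonic_coefE (c : nat -> nat -> R) d k :
  (forall k, (k.+2 <= d)%N ->
    c d k.+2 * (k.+1%:R * k.+2%:R) = - c d k * ((d - k)%:R * (d - k.+1)%:R)) ->
  (0 < d)%N -> (k <= d)%N ->
  c d k = 'C(d, k)%:R * complex.Re (holomorphic_coef c d * 'i ^+ k).
Proof.
move=> H d0.
elim/ltn_ind: k => -[|[|k]] IH kd.
- by rewrite bin0 mul1r expr0 mulr1.
- rewrite bin1 expr1 /= mulr0 mulr1 sub0r opprK mulrCA divff ?mulr1 // pnatr_eq0 -lt0n //.
have n1 : (k.+1%:R * k.+2%:R : R) != 0 by rewrite mulf_neq0 // pnatr_eq0.
apply: (mulIf n1); rewrite H // (IH k) ?(ltnW (ltnW kd)) //.
have e : ('C(d, k.+2)%:R * (k.+1%:R * k.+2%:R) : R) = 'C(d, k)%:R * ((d - k)%:R * (d - k.+1)%:R).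
  rewrite -!natrM; congr (_%:R).
  by rewrite mulnCA [('C(d, k.+2) * _)%N]mulnC mul_bin_left mulnCA mul_bin_left; lia.
have i2 : holomorphic_coef c d * 'i ^+ k.+2 = - (holomorphic_coef c d * 'i ^+ k).
  by rewrite -addn2 exprD sqr_i mulrN1 mulrN.
rewrite i2 raddfN /= mulrAC e; ring.
Qed.

Lemma expand_complex_power (w : R[i]) d (x y : R) :
  w * (x +i* y) ^+ d =
  \sum_(k < d.+1) ('C(d, k)%:R * (x ^+ (d - k) * y ^+ k))%:C * (w * 'i ^+ k).
Proof.
rewrite [_ +i* _]complexE /= exprDn mulr_sumr; apply: eq_bigr => k _.
rewrite !rmorphM !rmorphXn rmorph_nat /= exprMn -mulr_natl; ring.
Qed.

Lemma Re_scale (a : R) (z : R[i]) : complex.Re (a%:C * z) = a * complex.Re z.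
Proof. by case: z => p q /=; rewrite mul0r subr0. Qed.
Lemma Im_scale (a : R) (z : R[i]) : complex.Im (a%:C * z) = a * complex.Im z.
Proof. by case: z => p q /=; rewrite mul0r addr0. Qed.
Lemma Im_mul_i (z : R[i]) : complex.Im (z * 'i) = complex.Re z.
Proof. by case: z => p q /=; rewrite mulr1 mulr0 addr0. Qed.

Lemma Re_sum n (F : 'I_n -> R[i]) :
  complex.Re (\sum_(i < n) F i) = \sum_(i < n) complex.Re (F i).
Proof. exact: raddf_sum. Qed.
Lemma Im_sum n (F : 'I_n -> R[i]) :
  complex.Im (\sum_(i < n) F i) = \sum_(i < n) complex.Im (F i).
Proof. exact: raddf_sum. Qed.

Section Degree.
Variables (c : nat -> nat -> R) (d : nat).
Hypotheses (d0 : (0 < d)%N) (H : forall k, (k.+2 <= d)%N ->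
    c d k.+2 * (k.+1%:R * k.+2%:R) = - c d k * ((d - k)%:R * (d - k.+1)%:R)).

Lemma binary_form_Re x y : binary_form c d x y = complex.Re (holomorphic_coef c d * (x +i* y) ^+ d).
Proof.
rewrite expand_complex_power Re_sum; apply: eq_bigr => k _.
rewrite Re_scale [in LHS](harmonic_coefE H) -1?ltnS //; ring.
Qed.

(** Along the path through (x,0), the conjugate of the real part of w z^d is its
    imaginary part. *)
Lemma conj_poly_Im x y :
  (conj_polyY c d x).[y] + (conj_polyX c d 0).[x] = complex.Im (holomorphic_coef c d * (x +i* y) ^+ d).
Proof.
rewrite expand_complex_power Im_sum big_ord_recl addrC; congr (_ + _).
  rewrite hornerN horner_sum -(prednK d0) 2!big_ord_recl big1 => [|k _] /=; last first.
    by rewrite hornerZ expr0n (_ : (_ == _) = false) // mulr0 mul0r.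
  rewrite !hornerZ !hornerXn /bump /= !addn0 !expr0 bin0 !subn0 subSS subn0.
  move: (d.-1.+1%:R^-1) => e; ring.
rewrite horner_sum big_ord_recr /= subnn mulr0n !(mul0r, mulr0, scale0r, horner0, addr0).
apply: eq_bigr => k _; rewrite hornerZ hornerXn /bump /= add1n.
rewrite Im_scale (_ : _ * _ = holomorphic_coef c d * 'i ^+ k * 'i); last by rewrite exprSr mulrA.
rewrite Im_mul_i (harmonic_coefE H) ?(ltnW (ltn_ord k)) //.
have e : ('C(d, k)%:R * (d - k)%:R : R) = 'C(d, k.+1)%:R * k.+1%:R.
  by rewrite -!natrM [in RHS]mulnC mul_bin_left mulnC.
have n0 : (k.+1%:R : R) != 0 by rewrite pnatr_eq0.
have -> : ('C(d, k.+1)%:R : R) = 'C(d, k)%:R * (d - k)%:R / k.+1%:R by rewrite e mulfK.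
rewrite -subnS; ring.
Qed.
End Degree.

Lemma norm_le_ReIm (z : R[i]) : `|z| <= (`|complex.Re z| + `|complex.Im z|)%:C.
Proof.
case: z => a b /=; rewrite [a +i* b]complexE /=; apply: le_trans (ler_normD _ _) _.
rewrite rmorphD /= normrM; apply: lerD; first by rewrite normc_def /= expr0n addr0 sqrtr_sqr.
by rewrite !normc_def /= !expr0n /= !(expr1n, addr0, add0r) sqrtr1 sqrtr_sqr mul1r.
Qed.

Lemma norm_ge_Im (z : R[i]) : `|complex.Im z|%:C <= `|z|.
Proof.
case: z => a b; rewrite normc_def /= lecR -sqrtr_sqr ler_wsqrtr // lerDr sqr_ge0 //.
Qed.

(** No Cauchy integral is needed: the Taylor series of the real part u is rewritten as the real part of
    a complex power series, and the conjugate v, integrated along segments, is its imaginary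
    part up to the constant v(0,0). *)
Lemma holomorphic_power_series (r M : R) (c : nat -> nat -> R) (u v p q : R -> R -> R) :
  0 < r -> real_series r M c u ->
  (forall x y : R, `|x| < r -> `|y| < r ->
    [/\ is_derive x 1 (u^~ y) (p x y), is_derive y 1 (u x) (q x y),
        is_derive y 1 (v x) (p x y) & is_derive x 1 (v^~ y) (- q x y)]) ->
  exists alpha N, power_series ((r / 2)%:C : R[i])
    (fun z => u (complex.Re z) (complex.Im z) +i* v (complex.Re z) (complex.Im z)) alpha N.
Proof.
move=> r0 hu CR.
have M0 : 0 <= M by have := hu.1 0%N; rewrite big_ord0.
have harm d k : (k.+2 <= d)%N ->
    c d k.+2 * (k.+1%:R * k.+2%:R) = - c d k * ((d - k)%:R * (d - k.+1)%:R).
  by apply: harmonic_coef => x y; apply: (conj_path_independent r0 hu CR).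
pose v0 := v 0 0.
(* The value v(0,0) enters as the imaginary part of the constant term. *)
pose al d : R[i] := holomorphic_coef c d + (if d is 0 then v0 else 0)%:C * 'i.
have alS d : al d.+1 = holomorphic_coef c d.+1 by rewrite /al /= rmorph0 mul0r addr0.
have al0 : al 0%N = c 0%N 0%N +i* v0.
  by rewrite /al /holomorphic_coef mulr0n invr0 mulr0 oppr0; apply/eqP; rewrite eq_complex /=; apply/andP; split; apply/eqP; ring.
have ReE d x y : complex.Re (al d * (x +i* y) ^+ d) = binary_form c d x y.
  case: d => [|d]; last by rewrite alS (binary_form_Re _ (harm _)).
  by rewrite al0 expr0 mulr1 /binary_form big_ord1 !expr0 !mulr1.
have ImE d x y : complex.Im (al d * (x +i* y) ^+ d) =
    (conj_polyY c d x).[y] + (conj_polyX c d 0).[x] + (if d is 0 then v0 else 0).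
  case: d => [|d]; last by rewrite alS -(conj_poly_Im _ (harm _)) // addr0.
  rewrite al0 expr0 mulr1 /= /conj_polyY /conj_polyX !big_ord1 !(mulr0n, mulr0, mul0r, scale0r).
  by rewrite oppr0 !horner0 !add0r.
have c0M : `|c 0%N 0%N| <= M.
  by have := hu.1 1%N; rewrite !big_ord1 expr0 mulr1.
have hom00 n : \sum_(d < n.+1) binary_form c d 0 0 = c 0%N 0%N.
  rewrite big_ord_recl big1 => [|d _]; first by rewrite /binary_form big_ord1 !expr0 !mulr1 addr0.
  by rewrite /binary_form big1 // => k _; rewrite -exprD subnK -1?ltnS // exprS mul0r mulr0.
have u0 : u 0 0 = c 0%N 0%N.
  apply/eqP; rewrite -subr_eq0 -normr_le0.
  apply: (@cvg_norm_le _ (fun n => \sum_(d < n) binary_form c d 0 0 - c 0%N 0%N) _ _ 1).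
    by apply: cvgB; [apply: hu.2; rewrite normr0|exact: cvg_cst].
  by move=> [|n] // _; rewrite hom00 subrr normr0.
pose C d := \sum_(k < d.+1) `|c d k|.
have alle d : `|al d| <= (C d + (if d is 0 then `|v0| else 0))%:C.
  apply: le_trans (norm_le_ReIm _) _; rewrite lecR.
  case: d => [|d]; first by rewrite al0 /= /C big_ord1.
  rewrite alS /= addr0 normrN normrM /C big_ord_recl lerD2l big_ord_recl.
  apply: (@le_trans _ _ `|c d.+1 1%N|); last by rewrite lerDl sumr_ge0.
  by rewrite ler_piMr // normfV invf_le1 ?normr_gt0 ?pnatr_eq0 // normr_nat ler1n.
have rho0 : 0 < r / 2 by rewrite divr_gt0.
exists al, ((4 * M + `|v0|)%:C); split=> [n|n tau z zt tr].
  apply: (@le_trans _ _ (\sum_(k < n) ((C k * r ^+ k) + (if k == 0%N :> nat then `|v0| else 0))%:C)).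
    apply: ler_sum => k _.
    apply: (@le_trans _ _ ((C k + (if k == 0%N :> nat then `|v0| else 0))%:C * (r ^+ k)%:C)).
      apply: ler_pM => //; first by rewrite exprn_ge0 // lecR ltW.
        by have := alle k; case: (k : nat).
      rewrite -rmorphXn lecR lerXn2r ?nnegrE ?ltW //.
      by rewrite ltr_pdivrMr // ltr_pMr // ltr1n.
    rewrite -rmorphM lecR mulrDl lerD2l; case: eqP => [->|_]; last by rewrite mul0r.
    by rewrite expr0 mulr1.
  rewrite -rmorph_sum lecR big_split /=; apply: lerD.
    by apply: le_trans (hu.1 n) _; rewrite ler_peMl // ler1n.
  case: n => [|n]; first by rewrite big_ord0.
  by rewrite big_ord_recl big1 ?addr0.
have t0 : 0 < tau by apply: le_lt_trans zt.
have [t taut] : exists t : R, tau = t%:C.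
  exists (complex.Re tau); move: t0; case: tau {zt tr} => a b; rewrite ltcE /= => /andP[/eqP -> _] //.
move: zt tr t0; rewrite {}taut => zt; rewrite lecR ltcR => tr t0.
have xt : `|complex.Re z| < t by rewrite -ltcR (le_lt_trans (normc_ge_Re _)).
have yt : `|complex.Im z| < t by rewrite -ltcR (le_lt_trans (norm_ge_Im _)).
have zt0 : `|0 : R| < t by rewrite normr0.
case: z xt yt {zt} => x y /= xt yt.
have q0 : 0 <= (t / (r / 2)) ^+ n by rewrite exprn_ge0 // divr_ge0 ?ltW.
rewrite -fmorphV -rmorphM -rmorphXn -rmorphM.
apply: le_trans (norm_le_ReIm _) _; rewrite lecR.
have -> : complex.Re (u x y +i* v x y - taylor_sum al n (x +i* y)) = u x y - \sum_(d < n) binary_form c d x y.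
  by rewrite raddfB /= Re_sum; congr (_ - _); apply: eq_bigr => d _; rewrite ReE.
have -> : complex.Im (u x y +i* v x y - taylor_sum al n (x +i* y)) =
  (v x y - v x 0 - \sum_(d < n) (conj_polyY c d x).[y]) +
  (v x 0 - v 0 0 - \sum_(d < n) (conj_polyX c d 0).[x]) + (if n is 0 then v0 else 0).
  have ImS : complex.Im (taylor_sum al n (x +i* y)) = \sum_(d < n) ((conj_polyY c d x).[y] +
      (conj_polyX c d 0).[x] + (if (d : nat) is 0 then v0 else 0)).
    by rewrite Im_sum; apply: eq_bigr => d _; apply: ImE.
  rewrite raddfB /= ImS !big_split /= /v0.
  case: n {q0 ImS} => [|n]; first by rewrite !big_ord0; ring.
  rewrite [X in _ - (_ + X)]big_ord_recl [X in _ - (_ + (_ + X))]big1 //= !addr0.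
  move: (\sum_(i < n.+1) (conj_polyY c i x).[y]) (\sum_(i < n.+1) (conj_polyX c i 0).[x]) => S1 S2; ring.
have [B1 _] := conj_remainder r0 hu CR n xt yt tr.
have [_ B2] := conj_remainder r0 hu CR n xt zt0 tr.
have A : `|u x y - \sum_(d < n) binary_form c d x y| <= 2 * M * (t / (r / 2)) ^+ n.
  have := @remainder_lipschitz _ _ _ _ _ r0 hu n x 0 y 0 t t t0 tr (ltW xt) (ltW zt0)
    (ltW yt) (ltW zt0).
  rewrite !subr0 => /(_ (ltW xt) (ltW yt)).
  rewrite mulrAC divfK ?gt_eqF // u0.
  case: n q0 {B1 B2} => [|n] q0.
    rewrite !big_ord0 !subr0 expr0 !mulr1 => h.
    rewrite -[u x y](subrK (c 0%N 0%N)); apply: le_trans (ler_normD _ _) _.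
    by rewrite mulrDl mul1r; apply: lerD.
  rewrite hom00 subrr subr0 => h; apply: le_trans h _.
  by rewrite -mulrA ler_peMl ?mulr_ge0 // ler1n.
have V : `|if n is 0 then v0 else 0| <= `|v0| * (t / (r / 2)) ^+ n.
  by case: n q0 {A B1 B2} => [|n] q0; rewrite ?expr0 ?mulr1 // normr0 mulr_ge0.
apply: le_trans (lerD A (le_trans (ler_normD _ _) (lerD (le_trans (ler_normD _ _) (lerD B1 B2)) V))) _.
by rewrite le_eqVlt; apply/orP; left; apply/eqP; ring.
Qed.
End Holo.

(** * Restricting power series in many variables to a coordinate plane *)

Section Multi.

Lemma big_bmultinom_degree (V : nmodType) (N n : nat) (G : multinom N -> V) :
  \sum_(nu : bmultinom N n) G nu
  = \sum_(d < n) \sum_(nu : bmultinom N d.+1 | mdeg nu == d) G nu.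
Proof.
pose dg (nu : bmultinom N n) : 'I_n := Ordinal (bmdeg nu).
rewrite (partition_big dg xpredT) //=; apply: eq_bigr => d _.
pose h (nu : bmultinom N d.+1) : bmultinom N n :=
  BMultinom (leq_trans (bmdeg nu) (ltn_ord d)).
have z0 : (mdeg (@mnm0 N) < d.+1)%N by rewrite mdeg0.
pose h' (nu : bmultinom N n) : bmultinom N d.+1 := insubd (BMultinom z0) (nu : multinom N).
rewrite (reindex_onto h h') /=; last first.
  move=> nu /eqP e; apply/val_inj => /=; rewrite val_insubd.
  by rewrite (_ : (mdeg nu < d.+1)%N) // -e.
apply: eq_bigl => nu; rewrite -val_eqE /=.
have -> : h' (h nu) == nu by apply/eqP/val_inj; rewrite val_insubd /= bmdeg.
by rewrite andbT.
Qed.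

Variables (R : realType) (N : nat) (i0 i1 : 'I_N).
Hypothesis i01 : i0 != i1.

Definition plane_pt (x y : R) : 'rV[R]_N :=
  \row_i (if i == i0 then x else if i == i1 then y else 0).

Lemma plane_monomial (nu : multinom N) (x y : R) :
  \prod_(i < N) (if i == i0 then x else if i == i1 then y else 0) ^+ fun_of_multinom nu i =
  if [forall i, (i == i0) || (i == i1) || (fun_of_multinom nu i == 0%N)]
  then x ^+ (mdeg nu - fun_of_multinom nu i1) * y ^+ fun_of_multinom nu i1 else 0.
Proof.
have i10 : i1 != i0 by rewrite eq_sym.
case: (boolP [forall i, _]) => [/forallP s|/fintype.forallPn [j]].
  have other i : i != i0 -> i != i1 -> fun_of_multinom nu i = 0%N.
    by move=> a b; have := s i; rewrite (negbTE a) (negbTE b) /= => /eqP.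
  rewrite (bigD1 i0) //= eqxx (bigD1 i1) //= eqxx big1 ?mulr1; last first.
    by move=> i /andP[a b]; rewrite (other i) ?expr0.
  rewrite (negbTE i10); congr (_ ^+ _ * _).
  rewrite mdegE (bigD1 i0) //= (bigD1 i1) //= big1 ?addn0 ?addnK //.
  by move=> i /andP[a b]; apply: other.
rewrite !negb_or -andbA => /and3P[a b e].
by rewrite (bigD1 j) //= (negbTE a) (negbTE b) expr0n (negbTE e) mul0r.
Qed.

(** On a coordinate plane only the monomials in the two coordinates survive; they are grouped
    by total degree and by the exponent of the second coordinate. *)
Lemma analytic_plane (h : 'rV[R]_N -> R) (a b : R) :
  analytic_at h (plane_pt a b) ->
  exists r M c, 0 < r /\ real_series r M c (fun x y => h (plane_pt (a + x) (b + y))).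
Proof.
case=> c0 [r [r0 cv ex]].
pose supp (nu : multinom N) := [forall i, (i == i0) || (i == i1) || (fun_of_multinom nu i == 0%N)].
pose c d k := \sum_(nu : bmultinom N d.+1 | [&& mdeg nu == d, fun_of_multinom nu i1 == k & supp nu]) c0 nu.
have part (V : nmodType) d (T : multinom N -> V) :
    \sum_(nu : bmultinom N d.+1 | (mdeg nu == d) && supp nu) T nu =
    \sum_(k < d.+1) \sum_(nu : bmultinom N d.+1 |
       [&& mdeg nu == d, fun_of_multinom nu i1 == k & supp nu]) T nu.
  have le (nu : bmultinom N d.+1) : (fun_of_multinom nu i1 < d.+1)%N.
    by apply: leq_ltn_trans (bmdeg nu); rewrite mdegE (bigD1 i1) //= leq_addr.
  rewrite (partition_big (fun nu => Ordinal (le nu)) xpredT) //=.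
  by apply: eq_bigr => k _; apply: eq_bigl => nu; rewrite -val_eqE /= andbAC andbA.
exists r, (limn (fun d : nat => \sum_(nu : bmultinom N d) `|c0 nu| * r ^+ mdeg nu)), c.
split=> //; split=> [n|x y xr yr].
  have nd : nondecreasing_seq (fun d : nat => \sum_(nu : bmultinom N d) `|c0 nu| * r ^+ mdeg nu).
    apply/nondecreasing_seqP => m.
    rewrite !(big_bmultinom_degree _ (fun nu => `|c0 nu| * r ^+ mdeg nu)) big_ord_recr /= lerDl.
    by apply: sumr_ge0 => nu _; rewrite mulr_ge0 // exprn_ge0 // ltW.
  apply: le_trans (nondecreasing_cvgn_le nd cv n).
  rewrite (big_bmultinom_degree _ (fun nu => `|c0 nu| * r ^+ mdeg nu)); apply: ler_sum => d _.
  rewrite (eq_bigr (fun nu : bmultinom N d.+1 => `|c0 nu| * r ^+ d)); last by move=> nu /eqP ->.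
  rewrite -mulr_suml ler_wpM2r ?exprn_ge0 ?(ltW r0) //.
  rewrite [leRHS](bigID (fun nu : bmultinom N d.+1 => supp nu)) /= -[leLHS]addr0.
  apply: lerD; last exact: sumr_ge0.
  rewrite (part _ _ (fun nu => `|c0 nu|)); apply: ler_sum => k _; exact: ler_norm_sum.
have := ex (plane_pt (a + x) (b + y)).
have dif i : plane_pt (a + x) (b + y) 0 i - plane_pt a b 0 i =
   if i == i0 then x else if i == i1 then y else 0.
  by rewrite !mxE; case: ifP => _; [ring|case: ifP => _; ring].
have small i : `|plane_pt (a + x) (b + y) 0 i - plane_pt a b 0 i| < r.
  by rewrite dif; case: ifP => // _; case: ifP => // _; rewrite normr0.
move=> /(_ small) lim; apply: cvg_trans lim; apply: near_eq_cvg; apply: nearW => n.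
under eq_bigr do under eq_bigr do rewrite dif.
rewrite (big_bmultinom_degree _ (fun nu => c0 nu * \prod_(i < N) (if i == i0 then x else if i == i1 then y else 0) ^+ fun_of_multinom nu i)).
apply: eq_bigr => d _.
rewrite (bigID (fun nu : bmultinom N d.+1 => supp nu)) /= [X in _ + X]big1 ?addr0; last first.
  by move=> nu /andP[_ s]; rewrite plane_monomial -/(supp nu) (negbTE s) mulr0.
rewrite (part _ _ (fun nu => c0 nu * \prod_(i < N) (if i == i0 then x else if i == i1 then y else 0) ^+ fun_of_multinom nu i)).
apply: eq_bigr => k _; rewrite /c mulr_suml; apply: eq_bigr => nu /and3P[/eqP e1 /eqP e2 s].
by rewrite plane_monomial -/(supp nu) s e1 e2.
Qed.
End Multi.

(** * Nonvanishing points of polynomials, and continuity of analytic functions *)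

Section Mpoly.

Lemma rmorph_mmap (n : nat) (R S T : comNzRingType) (phi : {rmorphism S -> T})
  (f : R -> S) (h : 'I_n -> S) (P : mpoly n R) :
  phi (mmap f h P) = mmap (phi \o f) (phi \o h) P.
Proof.
rewrite /mmap rmorph_sum; apply: eq_bigr => m _.
rewrite rmorphM /= /mmap1 rmorph_prod; congr (_ * _).
by apply: eq_bigr => i _; rewrite rmorphXn.
Qed.

Lemma digits_inj n D (f g : 'I_n -> nat) :
  (forall i, f i < D)%N -> (forall i, g i < D)%N ->
  (\sum_(i < n) f i * D ^ i = \sum_(i < n) g i * D ^ i)%N -> f =1 g.
Proof.
elim: n f g => [|n IH] f g hf hg; first by move=> _ [].
have D0 : (0 < D)%N by apply: leq_ltn_trans (hf ord0).
have S (e : 'I_n.+1 -> nat) : (\sum_(i < n.+1) e i * D ^ i =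
    (\sum_(i < n) e (lift ord0 i) * D ^ i) * D + e ord0)%N.
  rewrite big_ord_recl expn0 muln1 addnC big_distrl /=; congr (_ + _)%N.
  by apply: eq_bigr => i _; rewrite /bump add1n expnSr mulnA.
rewrite !S => e.
have e0 : f ord0 = g ord0.
  by move/(congr1 (modn^~ D)): e; rewrite !modnMDl !modn_small.
have eS : (\sum_(i < n) f (lift ord0 i) * D ^ i = \sum_(i < n) g (lift ord0 i) * D ^ i)%N.
  by move/(congr1 (divn^~ D)): e; rewrite !divnMDl // !divn_small // !addn0.
move=> i; case: (unliftP ord0 i) => [j ->|-> //].
exact: (IH (fun i => f (lift ord0 i)) (fun i => g (lift ord0 i))).
Qed.

Variable K : numFieldType.

Lemma poly_nonroot (p : {poly K}) : p != 0 -> exists x, p.[x] != 0.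
Proof.
move=> p0; apply: contrapT => /forallNP h; case/eqP: p0.
apply: (@poly_vanish _ p (fun i => i%:R)).
  by move=> i j /eqP; rewrite eqr_nat => /eqP.
by move=> i; apply/eqP/negPn/negP; apply: h.
Qed.

(** Kronecker's substitution of the powers x^(D^i) for the variables, with D above all exponents,
    keeps distinct monomials distinct and so gives a nonzero polynomial in one variable. *)
Lemma mpoly_nonroot n (P : mpoly n K) : P != 0 -> exists v, meval v P != 0.
Proof.
move=> P0; pose D := msize P.
pose Q : {poly K} := mmap polyC (fun i : 'I_n => 'X^(D ^ i)%N) P.
have QE : Q = \sum_(m <- msupp P) mcoeff m P *: 'X^(\sum_(i < n) fun_of_multinom m i * D ^ i)%N.
  apply: eq_bigr => m _; rewrite mul_polyC; congr (_ *: _).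
  rewrite /mmap1 -prodrXr; apply: eq_bigr => i _.
  by rewrite -exprM mulnC.
have Q0 : Q != 0.
  have [m0 m0P] : exists m0, m0 \in msupp P.
    by case E: (msupp P) => [|m s]; [move: P0; rewrite -msupp_eq0 E|exists m; rewrite mem_head].
  apply/eqP => /(congr1 (fun p : {poly K} => p`_(\sum_(i < n) fun_of_multinom m0 i * D ^ i)%N)).
  rewrite QE coef0 coef_sum (bigD1_seq m0) ?msupp_uniq //= coefZ coefXn eqxx mulr1 big1_seq.
    by move/eqP; rewrite addr0; apply/negP; rewrite -mcoeff_msupp.
  move=> m /andP[mm0 mP]; rewrite coefZ coefXn; case: eqP => e; last by rewrite mulr0.
  case/eqP: mm0; apply/mnmP => i.
  have lt (m' : multinom n) j : m' \in msupp P -> (fun_of_multinom m' j < D)%N.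
    move=> /msize_mdeg_lt; apply: leq_ltn_trans.
    by rewrite mdegE (bigD1 j) //= leq_addr.
  by apply/esym/(digits_inj _ _ e) => j; apply: lt.
have [x Qx] := poly_nonroot Q0; exists (fun i => x ^+ (D ^ i)).
move: Qx; congr (_ != 0); rewrite -[LHS]/(horner_eval x Q) rmorph_mmap /meval /mmap.
apply: eq_bigr => m _; rewrite /= /horner_eval hornerC; congr (_ * _).
by apply: eq_bigr => i _; rewrite /= /horner_eval hornerXn.
Qed.
End Mpoly.

Section Continuity.
Variable R : realType.

(** Analytic functions are continuous, here with a linear modulus in the sup norm. *)
Lemma analytic_near (N : nat) (h : 'rV[R]_N -> R) (a : 'rV[R]_N) : analytic_at h a ->
  exists r K : R, [/\ 0 < r, 0 <= K & forall (tau : R) (x : 'rV[R]_N), 0 < tau -> tau < r ->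
    (forall i, `|x 0 i - a 0 i| <= tau) -> `|h x - h a| <= K * tau].
Proof.
case=> c [r [r0 cv ex]].
pose T n (y : 'rV[R]_N) := \sum_(nu : bmultinom N n)
  c nu * \prod_(i < N) (y 0 i - a 0 i) ^+ fun_of_multinom nu i.
pose S n := \sum_(nu : bmultinom N n) `|c nu| * r ^+ mdeg nu.
pose M := limn S.
have SE n : S n = \sum_(d < n) \sum_(nu : bmultinom N d.+1 | mdeg nu == d) `|c nu| * r ^+ mdeg nu.
  exact: (big_bmultinom_degree _ (fun nu => `|c nu| * r ^+ mdeg nu)).
have SM n : S n <= M.
  apply: nondecreasing_cvgn_le => //; apply/nondecreasing_seqP => m.
  rewrite !SE big_ord_recr /= lerDl.
  by apply: sumr_ge0 => nu _; rewrite mulr_ge0 // exprn_ge0 // ltW.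
have M0 : 0 <= M by apply: le_trans (SM 0%N); rewrite SE big_ord0.
pose k0 := \sum_(nu : bmultinom N 1 | mdeg nu == 0%N) c nu.
have bnd (tau : R) (x : 'rV[R]_N) : 0 < tau -> tau < r -> (forall i, `|x 0 i - a 0 i| <= tau) ->
    `|h x - k0| <= tau / r * M.
  move=> t0 tr xa.
  apply: (@cvg_norm_le _ (fun n => T n x - k0) _ _ 1).
    by apply: cvgB; [apply: ex => i; apply: le_lt_trans tr|exact: cvg_cst].
  move=> [|n] // _; rewrite /T.
  rewrite (big_bmultinom_degree _ (fun nu => c nu * \prod_(i < N) (x 0 i - a 0 i) ^+ fun_of_multinom nu i)).
  rewrite big_ord_recl /= (eq_bigr (fun nu : bmultinom N 1 => c nu)); last first.
    move=> nu /eqP nu0; rewrite big1 ?mulr1 // => i _.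
    have := leqnn (mdeg nu); rewrite {2}nu0 {1}mdegE (bigD1 i) //= leqn0 addn_eq0.
    by case/andP => /eqP ->.
  rewrite -/k0 addrC addKr.
  apply: (@le_trans _ _ (tau / r * (S n.+1))); last by rewrite ler_wpM2l // divr_ge0 // ltW.
  rewrite SE big_ord_recl mulrDr -[leLHS]add0r; apply: lerD.
    apply: mulr_ge0; first by rewrite divr_ge0 // ltW.
    apply: sumr_ge0 => nu _.
    by rewrite mulr_ge0 // exprn_ge0 // ltW.
  apply: le_trans (ler_norm_sum _ _ _) _; rewrite mulr_sumr; apply: ler_sum => d _.
  apply: le_trans (ler_norm_sum _ _ _) _; rewrite mulr_sumr; apply: ler_sum => nu /eqP nud.
  rewrite normrM mulrCA ler_wpM2l // normr_prod.
  apply: (@le_trans _ _ (\prod_(i < N) tau ^+ fun_of_multinom nu i)).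
    by apply: ler_prod => i _; rewrite normr_ge0 normrX lerXn2r // nnegrE // ltW.
  rewrite prodrXr -mdegE nud /bump add1n !exprS mulrA divfK ?gt_eqF // ler_pM2l //.
  by rewrite lerXn2r // ?nnegrE ltW.
exists r, (2 * M / r); split=> // [|tau x t0 tr xa].
  by rewrite divr_ge0 ?mulr_ge0 // ltW.
have h1 := bnd tau x t0 tr xa.
have h2 : `|h a - k0| <= tau / r * M by apply: bnd => // i; rewrite subrr normr0 ltW.
have -> : h x - h a = (h x - k0) - (h a - k0) by ring.
apply: le_trans (ler_normB _ _) _; apply: le_trans (lerD h1 h2) _.
by rewrite le_eqVlt; apply/orP; left; apply/eqP; ring.
Qed.
End Continuity.

(** * Restricting algebraic relations to a coordinate plane *)

Section Reduction.
Variable R : realType.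

Lemma cvg_meval n (P : mpoly n R) (w : R -> 'I_n -> R) (w0 : 'I_n -> R) (F : set_system R)
  (FF : Filter F) :
  (forall i, (fun e => w e i) @ F --> w0 i) ->
  (fun e => meval (w e) P) @ F --> meval w0 P.
Proof.
move=> h; rewrite /meval /mmap.
apply: cvg_big => [|m _]; first exact: add_continuous.
apply: cvgM; first exact: cvg_cst.
rewrite /mmap1; apply: cvg_big => [|i _]; first exact: mul_continuous.
elim: (fun_of_multinom m i) => [|k IH]; first exact: cvg_cst.
by under eq_fun do rewrite exprS; rewrite exprS; apply: cvgM.
Qed.

Lemma cvg_sum_ord n (f : 'I_n -> R -> R) (a : 'I_n -> R) (F : set_system R)
  (FF : Filter F) :
  (forall j, f j @ F --> a j) -> (fun e => \sum_(j < n) f j e) @ F --> \sum_(j < n) a j.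
Proof. by move=> h; apply: cvg_big => //; exact: add_continuous. Qed.

Definition triple (K : nzRingType) (x y t : K) (i : 'I_3) : K := nth 0 [:: x; y; t] i.

Section Plane.
Variables (N : nat) (i0 i1 : 'I_N) (P : mpoly (N + 1) R).

Let X (j : nat) : mpoly 3 R := mpolyX R (mnm1 (inord j : 'I_3)).
Let base (i : 'I_N) : mpoly 3 R := if i == i0 then X 0 else if i == i1 then X 1 else 0.

(** The polynomial P along the point of the plane with coordinates (x,y), moved by the multiple
    eps s of a transversal direction [s]: a polynomial in eps whose coefficients are
    polynomials in x, y and the value t. *)
Definition pencil (s : 'I_N -> R) : {poly (mpoly 3 R)} :=
  mmap (fun r => (mpolyC 3 r)%:P)
    (fun j => match fintype.split j with
              | inl i => (base i)%:P + (mpolyC 3 (s i))%:P * 'X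
              | inr _ => (X 2)%:P end) P.

Lemma pencil_eval s (x y t e : R) :
  (map_poly (meval (triple x y t)) (pencil s)).[e] =
  meval (fun j => row_mx (plane_pt i0 i1 x y + e *: \row_i s i) t%:M 0 j) P.
Proof.
rewrite -[LHS]/(horner_eval e (map_poly (meval (triple x y t)) (pencil s))).
rewrite (rmorph_mmap (map_poly (meval (triple x y t)))) (rmorph_mmap (horner_eval e)).
apply: eq_bigr => m _ /=; congr (_ * _).
  by rewrite /horner_eval map_polyC /= hornerC mevalC.
apply: eq_bigr => j _; congr (_ ^+ _); rewrite mxE /=; case: fintype.split => i.
  rewrite !mxE rmorphD rmorphM /= !map_polyC map_polyX /= /horner_eval !hornerE mevalC mulrC.
  congr (_ + _); rewrite /base; case: ifP => _; first by rewrite mevalXU /triple inordK.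
  by case: ifP => _; [rewrite mevalXU /triple inordK|rewrite meval0].
by rewrite map_polyC /horner_eval /= hornerC mevalXU /triple inordK // !mxE (ord1 i).
Qed.

(** P may vanish identically on the plane.  For a suitable direction s, its expansion in eps
    along the plane is nonzero; the lowest coefficient Q of this expansion is what remains
    after dividing the relation by a power of eps, and continuity of h lets eps tend to 0. *)
Lemma reduce_to_plane : P != 0 -> exists2 Q : mpoly 3 R, Q != 0 &
  forall (V : set 'rV[R]_N) (h : 'rV[R]_N -> R), open V ->
    (forall y, V y -> analytic_at h y) ->
    (forall y, V y -> meval (fun i => row_mx y (h y)%:M 0 i) P = 0) ->
  forall x y, V (plane_pt i0 i1 x y) ->
    meval (triple x y (h (plane_pt i0 i1 x y))) Q = 0.
Proof.
move=> P0.
have [s s0] : exists s, pencil s != 0.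
  have [v Pv] := mpoly_nonroot P0.
  exists (fun i => v (lshift 1 i)); apply: contra_neq Pv => e.
  have := pencil_eval (fun i => v (lshift 1 i)) 0 0 (v (rshift N ord0)) 1.
  rewrite e rmorph0 horner0 => ->; apply: meval_eq => j.
  rewrite mxE; case: (splitP j) => i ij; rewrite !mxE.
    by rewrite !if_same add0r mul1r; congr (v _); apply/val_inj.
  by rewrite (ord1 i) eqxx mulr1n; congr (v _); apply/val_inj; rewrite /= ij (ord1 i).
have ex : exists k, (pencil s)`_k != 0.
  by exists (size (pencil s)).-1; rewrite -lead_coefE lead_coef_eq0.
pose k := ex_minn ex.
exists ((pencil s)`_k); first by rewrite /k; case: ex_minnP.
move=> V h oV hV PV x y Vxy.
have low j : (j < k)%N -> (pencil s)`_j = 0.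
  rewrite /k; case: ex_minnP => m _ mm jm; apply/eqP; apply: contraTT jm => /mm.
  by rewrite -leqNgt.
pose pt e : 'rV[R]_N := plane_pt i0 i1 x y + e *: \row_i s i.
pose w e := triple x y (h (pt e)).
pose n := size (pencil s).
(* The relation along the transversal line, divided by the k-th power of e. *)
pose Th e := \sum_(j < n) (if (k <= j)%N then e ^+ (j - k) * meval (w e) (pencil s)`_j else 0).
have pt0 : pt 0 = plane_pt i0 i1 x y by rewrite /pt scale0r addr0.
have kn : (k < n)%N.
  rewrite /k; case: ex_minnP => m pm _; rewrite ltnNge; apply: contra pm => nm.
  by rewrite nth_default.
have Th0 : Th 0 = meval (w 0) (pencil s)`_k.
  rewrite /Th (bigD1 (Ordinal kn)) //= leqnn subnn expr0 mul1r big1 ?addr0 // => j jk.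
  case: ifP => // kj; rewrite expr0n subn_eq0 (_ : (j <= k)%N = false) ?mul0r //.
  apply/negbTE; rewrite -ltnNge ltn_neqAle kj andbT.
  by apply: contra_neq jk => e; apply/val_inj.
have cpt : pt e @[e --> (0:R)] --> pt 0.
  by apply: cvgD; [exact: cvg_cst|apply: cvgZr_tmp; exact: cvg_id].
have Vpt0 : V (pt 0) by rewrite pt0.
have ch : h (pt e) @[e --> (0:R)] --> h (pt 0).
  have [r [K [r0 K0 hK]]] := analytic_near (hV _ Vpt0).
  pose S := 1 + \sum_i `|s i|.
  have S0 : 0 < S by rewrite ltr_pwDl // sumr_ge0.
  apply/cvgrPdist_le => eps eps0.
  pose tau := Num.min (r / 2) (eps / (K + 1)).
  have K1 : 0 < K + 1 by rewrite ltr_wpDl.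
  have tau0 : 0 < tau by rewrite lt_min !divr_gt0.
  have taur : tau < r by rewrite gt_min ltr_pdivrMr // ltr_pMr // ltr1n.
  have : \forall e \near (0:R), `|e| < tau / S by apply: nbhs0_lt; rewrite divr_gt0.
  apply: filterS => e; rewrite ltr_pdivlMr // => eS.
  rewrite distrC; apply: (@le_trans _ _ (K * tau)).
    apply: hK => // i; have -> : pt e 0 i - pt 0 0 i = e * s i by rewrite pt0 !mxE; ring.
    rewrite normrM.
    apply: le_trans (ltW eS); rewrite ler_wpM2l // /S (bigD1 i) //= addrCA lerDl.
    by rewrite addr_ge0 // sumr_ge0.
  apply: (@le_trans _ _ ((K + 1) * tau)); first by rewrite ler_wpM2r ?(ltW tau0) // lerDl.
  by rewrite mulrC -ler_pdivlMr // ge_min lexx orbT.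
have cTh : Th e @[e --> (0:R)^'] --> Th 0.
  apply: (@cvg_trans _ (Th e @[e --> (0:R)])); first by move=> B; exact: nbhs_dnbhs.
  apply: (cvg_sum_ord (nbhs_filter (0:R))) => j; case: ifP => _; last exact: cvg_cst.
  apply: cvgM; first exact: exprn_continuous.
  apply: cvg_meval => -[[|[|[|i]]] Hi] //; rewrite /w /triple /=; try exact: cvg_cst.
have Thz : \forall e \near (0:R)^', Th e = 0.
  have nV : \forall e \near (0:R)^', V (pt e).
    by apply: nbhs_dnbhs; apply: cpt; apply: open_nbhs_nbhs.
  have : \forall e \near (0:R)^', e != 0 by exact: nbhs_dnbhs_neq.
  apply: filterS2 nV => e Ve en0.
  have := pencil_eval s x y (h (pt e)) e; rewrite (PV _ Ve).
  rewrite (horner_coef_wide _ (size_poly _ _)) => E.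
  apply: (mulfI (expf_neq0 k en0)); rewrite mulr0 -E /Th mulr_sumr.
  apply: eq_bigr => j _; rewrite coef_map /=.
  case: ifP => kj; last by rewrite mulr0 low ?meval0 ?mul0r // ltnNge kj.
  by rewrite mulrA -exprD subnKC // mulrC.
rewrite -pt0 -/(w 0) -Th0.
apply: (@cvg_unique _ _ (Th e @[e --> (0:R)^'])) => //.
by apply: cvg_near_cst.
Qed.
End Plane.
End Reduction.

(** * Algebraicity of a holomorphic function with algebraic real part *)

Section Separated.
Local Open Scope complex_scope.
Variable R : realType.
Local Notation C := R[i].
Variable rho : C.
Hypothesis rho0 : 0 < rho.
Implicit Types (F G : C -> C) (H : C -> C -> C).

Definition has_power_series F : Prop := exists alpha M, power_series rho F alpha M.

(** Finite sums of products F(z) G(w).  The ring they form contains the functions that occur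
    below, and each of them has a double Taylor expansion. *)
Inductive separated : (C -> C -> C) -> Prop :=
| separated_prod H F G : has_power_series F -> has_power_series G ->
    (forall z w, H z w = F z * G w) -> separated H
| separated_sum H H1 H2 : separated H1 -> separated H2 ->
    (forall z w, H z w = H1 z w + H2 z w) -> separated H.

Lemma has_power_series_mul F G : has_power_series F -> has_power_series G ->
  has_power_series (fun z => F z * G z).
Proof.
by move=> [a [M hF]] [b [N hG]]; have := power_series_mul rho0 hF hG; eexists; eexists; eauto.
Qed.

Lemma has_power_series_cst e : has_power_series (fun=> e).
Proof. by have := power_series_const e rho0; eexists; eexists; eauto. Qed.

Lemma has_power_series_shift e : has_power_series (fun z => e + z).
Proof.
have := power_series_add rho0 (power_series_const e rho0) (power_series_id rho0).
by eexists; eexists; eauto.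
Qed.

Lemma has_power_series_conj F : has_power_series F ->
  has_power_series (fun z => conjc (F (conjc z))).
Proof.
move=> [a [M hF]]; exists (fun k => conjc (a k)), M; split=> [n|n tau z zt tr].
  by under eq_bigr do rewrite normcJ; exact: hF.1.
have -> : taylor_sum (fun k => conjc (a k)) n z = conjc (taylor_sum a n (conjc z)).
  have -> : conjc (taylor_sum a n (conjc z)) = \sum_(k < n) conjc (a k * conjc z ^+ k).
    exact: rmorph_sum.
  by apply: eq_bigr => k _; rewrite conjcM conjcX conjcK.
by rewrite -[_ - _](rmorphB (@conjc R)) /= normcJ; apply: hF.2; rewrite ?normcJ //.
Qed.

Lemma separated_eq H H1 : separated H1 -> (forall z w, H z w = H1 z w) -> separated H.
Proof.
case=> [H2 F G hF hG e|H2 H3 H4 h3 h4 e] e1.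
  by apply: (separated_prod hF hG) => z w; rewrite e1.
by apply: (separated_sum h3 h4) => z w; rewrite e1.
Qed.

Lemma separated_mul H1 H2 : separated H1 -> separated H2 ->
  separated (fun z w => H1 z w * H2 z w).
Proof.
elim=> {H1} [H1 F G hF hG e|H1 H3 H4 _ IH3 _ IH4 e]; last first.
  move=> h2; apply: (separated_sum (IH3 h2) (IH4 h2)) => z w.
  by rewrite e mulrDl.
elim=> {H2} [H2 F2 G2 hF2 hG2 e2|H2 H3 H4 _ IH3 _ IH4 e2].
  apply: (separated_prod (has_power_series_mul hF hF2) (has_power_series_mul hG hG2)) => z w.
  by rewrite e e2; ring.
by apply: (separated_sum IH3 IH4) => z w; rewrite e2 mulrDr.
Qed.

Lemma separated_cst e : separated (fun _ _ => e).
Proof.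
apply: (separated_prod (has_power_series_cst e) (has_power_series_cst 1)) => z w.
by rewrite mulr1.
Qed.

Lemma separated_add_vars F G : has_power_series F -> has_power_series G ->
  separated (fun z w => F z + G w).
Proof.
move=> hF hG; apply: (@separated_sum _ (fun z w => F z * 1) (fun z w => 1 * G w)).
- exact: separated_prod hF (has_power_series_cst 1) _.
- exact: separated_prod (has_power_series_cst 1) hG _.
by move=> z w; rewrite mulr1 mul1r.
Qed.

Lemma separated_exp H n : separated H -> separated (fun z w => H z w ^+ n).
Proof.
move=> h; elim: n => [|n IH]; first exact: separated_cst.
by apply: separated_eq (separated_mul h IH) _ => z w; rewrite exprS.
Qed.

Lemma separated_mmap (Q : mpoly 3 R) X Y T : separated X -> separated Y -> separated T ->
  separated (fun z w => mmap (real_complex R) (triple (X z w) (Y z w) (T z w)) Q).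
Proof.
move=> hX hY hT; rewrite /mmap; elim: (msupp Q) => [|m s IH].
  by apply: separated_eq (separated_cst 0) _ => z w; rewrite big_nil.
pose m3 i := fun_of_multinom m i.
have hm := separated_mul (separated_cst (real_complex R (mcoeff m Q)))
  (separated_mul (separated_exp (m3 ord0) hX) (separated_mul
    (separated_exp (m3 (lift ord0 ord0)) hY) (separated_exp (m3 (lift ord0 (lift ord0 ord0))) hT))).
apply: (separated_sum hm IH) => z w; rewrite big_cons; congr (_ * _ + _).
by rewrite /mmap1 !big_ord_recl big_ord0 mulr1.
Qed.

Lemma separated_power_series2 H : separated H ->
  exists c M, power_series2 rho H c M.
Proof.
elim=> {H} [H F G [a [M hF]] [b [N hG]] e|H H1 H2 _ [c1 [M1 h1]] _ [c2 [M2 h2]] e].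
  exists (fun d k => a (d - k)%N * b k), (2 * M * N) => n tau z w zt wt tr.
  by rewrite e; apply: (power_series2_prod rho0 hF hG).
exists (fun d k => c1 d k + c2 d k), (M1 + M2) => n tau z w zt wt tr.
have -> : H z w - \sum_(d < n) binary_form (fun d k => c1 d k + c2 d k) d z w =
  (H1 z w - \sum_(d < n) binary_form c1 d z w) + (H2 z w - \sum_(d < n) binary_form c2 d z w).
  rewrite e addrACA -opprD -big_split /=; congr (_ - _); apply: eq_bigr => d _.
  by rewrite /binary_form -big_split /=; apply: eq_bigr => k _; rewrite mulrDl.
by rewrite mulrDl; apply: le_trans (ler_normD _ _) (lerD (h1 _ _ _ _ zt wt tr) (h2 _ _ _ _ zt wt tr)).
Qed.

Lemma separated_polarization H : separated H -> (forall z, `|z| < rho -> H z (conjc z) = 0) ->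
  forall z w, `|z| < rho / 2 -> `|w| < rho / 2 -> H z w = 0.
Proof.
by move=> /separated_power_series2 [c [M h]]; apply: polarization rho0 h.
Qed.

End Separated.

Section Algebraic.
Local Open Scope complex_scope.
Variable R : realType.
Local Notation C := R[i].

Lemma mmap_real (Q : mpoly 3 R) x y t :
  mmap (real_complex R) (triple x%:C y%:C t%:C) Q = (meval (triple x y t) Q)%:C.
Proof.
rewrite /meval -[RHS]/(real_complex R _) rmorph_mmap; apply: eq_bigr => m _; congr (_ * _).
by apply: eq_bigr => -[[|[|[|i]]] Hi].
Qed.

(** The polarized relation with the second variable held constant: [b] stands for the conjugate of a
    point and [e] for the conjugate of the value of the holomorphic function there. *)
Definition slice_poly (Q : mpoly 3 R) (b e : C) : {poly {poly C}} :=
  mmap (fun r => r%:C%:P%:P)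
    (triple ((2^-1)%:P * ('X + b%:P))%:P ((2 * 'i)^-1%:P * ('X - b%:P))%:P
            ((2^-1)%:P%:P * ('X + e%:P%:P))) Q.

Lemma slice_polyE Q b e (t z : C) :
  (slice_poly Q b e).[t%:P].[z] =
  mmap (real_complex R) (triple ((z + b) / 2) ((z - b) / (2 * 'i)) ((t + e) / 2)) Q.
Proof.
rewrite -[LHS]/(horner_eval z (horner_eval t%:P (slice_poly Q b e))).
rewrite (rmorph_mmap (horner_eval t%:P)) (rmorph_mmap (horner_eval z)).
apply: eq_bigr => m _; rewrite /= /horner_eval !hornerC; congr (_ * _).
apply: eq_bigr => i _; congr (_ ^+ _); case: i => -[|[|[|i]]] Hi //=; rewrite /triple /=.
- by rewrite !hornerE mulrC.
- by rewrite !hornerE mulrC.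
- by rewrite !hornerE mulrC.
Qed.

Lemma Re_conj (b : C) : (b + conjc b) / 2 = (complex.Re b)%:C.
Proof. by rewrite addcJ mulrC mulKf // pnatr_eq0. Qed.

Lemma Im_conj (b : C) : (b - conjc b) / (2 * 'i%C) = (complex.Im b)%:C.
Proof.
rewrite subcJ -mulrA mulrCA mulfK // mulf_neq0 ?pnatr_eq0 //.
by rewrite eq_complex /= oner_eq0 andbF.
Qed.

(** If all these specializations vanished, evaluating the one attached to b at z = b would give
    Q(Re b, Im b, s) = 0 for all b near a and all real s, so Q would vanish on an open set. *)
Lemma slice_poly_neq0 (Q : mpoly 3 R) (a : C) (r : R) (e : C -> C) : Q != 0 -> 0 < r ->
  exists2 b, `|b - a| < r%:C & slice_poly Q (conjc b) (e b) != 0.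
Proof.
move=> Q0 r0; apply: contrapT => h.
have Qz b s : `|b - a| < r%:C -> meval (triple (complex.Re b) (complex.Im b) s) Q = 0.
  move=> br; have qb : slice_poly Q (conjc b) (e b) = 0.
    by apply/eqP; apply: contrapT => /negP q; apply: h; exists b.
  have := slice_polyE Q (conjc b) (e b) (2 * s%:C - e b) b; rewrite qb !horner0.
  rewrite Re_conj Im_conj subrK mulrC mulKf ?pnatr_eq0 // mmap_real.
  by move=> /(congr1 (@complex.Re R)).
have [v] := mpoly_nonroot Q0; apply/negP/negPn.
pose x := complex.Re a; pose y := complex.Im a.
pose v0 := v (inord 0); pose v1 := v (inord 1); pose v2 := v (inord 2).
(* Q restricted to the segment from the point over a to a point where Q does not vanish. *)
pose p : {poly R} := mmap polyC
  (triple (x%:P + (v0 - x)%:P * 'X) (y%:P + (v1 - y)%:P * 'X) v2%:P) Q.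
have pE l : p.[l] = meval (triple (x + (v0 - x) * l) (y + (v1 - y) * l) v2) Q.
  rewrite -[LHS]/(horner_eval l p) rmorph_mmap; apply: eq_bigr => m _.
  rewrite /= /horner_eval hornerC; congr (_ * _); apply: eq_bigr => i _; congr (_ ^+ _).
  by case: i => -[|[|[|i]]] Hi //=; rewrite /triple /= !hornerE.
pose N := `|v0 - x| + `|v1 - y|.
have N1 : 0 < 1 + N by rewrite ltr_pwDl // addr_ge0.
have p0 : p = 0.
  apply: (@poly_vanish _ _ (fun k => r / (1 + N) / k.+1%:R)) => [i j /= e1|k].
    have e2 : (i.+1%:R : R) = j.+1%:R.
      by apply: invr_inj; apply: (mulfI _ e1); rewrite mulf_neq0 ?invr_eq0 ?gt_eqF.
    by move/eqP: e2; rewrite eqr_nat eqSS => /eqP.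
  set l := r / (1 + N) / k.+1%:R.
  have l0 : 0 <= l by rewrite !divr_ge0 // ltW.
  have lN : l <= r / (1 + N).
    by rewrite ler_pdivrMr // ler_peMr ?ler1n // divr_ge0 // ltW.
  move: l l0 lN => l l0 lN.
  rewrite pE; apply: (Qz (Complex (x + (v0 - x) * l) (y + (v1 - y) * l)) v2).
  apply: le_lt_trans (norm_le_ReIm _) _; rewrite ltcR !raddfB /= [x + _]addrC [y + _]addrC !addrK.
  rewrite !normrM -mulrDl -/N (ger0_norm l0).
  apply: (@le_lt_trans _ _ (N * (r / (1 + N)))).
    by rewrite ler_wpM2l ?addr_ge0.
  by rewrite mulrA ltr_pdivrMr // mulrC ltr_pM2l // ltrDr.
rewrite -(_ : p.[1] = meval v Q); first by rewrite p0 horner0.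
rewrite pE !mulr1 ![_ + (_ - _)]addrC !subrK; apply: meval_eq => i.
case: i => -[|[|[|i]]] Hi //; rewrite /triple /= /v0 /v1 /v2; congr (v _); apply/val_inj;
  by rewrite /= inordK.
Qed.

(** The relation Q(Re z, Im z, Re F(z)) = 0 holds at w = conj z for the polarized function, hence
    for all z and w near a; a good choice of w gives a relation between z and F(z). *)
Lemma holomorphic_algebraic (Q : mpoly 3 R) (F : C -> C) (a : C) (r : R) : Q != 0 -> 0 < r ->
  has_power_series r%:C (fun z => F (a + z)) ->
  (forall z, `|z - a| < r%:C -> meval (triple (complex.Re z) (complex.Im z) (complex.Re (F z))) Q = 0) ->
  exists2 q : {poly {poly C}}, q != 0 &
    forall z, `|z - a| < (r / 2)%:C -> q.[(F z)%:P].[z] = 0.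
Proof.
move=> Q0 r0 hF hQ.
have r0' : 0 < r%:C :> C by rewrite ltcR.
pose H (z w : C) : C := mmap (real_complex R)
  (triple (((a + z) + (conjc a + w)) / 2) (((a + z) + (- 1) * (conjc a + w)) / (2 * 'i%C))
    ((F (a + z) + conjc (F (a + conjc w))) / 2)) Q.
have sH : separated r%:C H.
  apply: (separated_mmap r0'); apply: (separated_mul r0' _ (separated_cst r0' _));
    apply: (separated_add_vars r0') => //; try exact: (has_power_series_shift r0').
    apply: (has_power_series_mul r0'); [exact: (has_power_series_cst r0')|exact: (has_power_series_shift r0')].
  exact: (has_power_series_conj hF).
have H0 z : `|z| < r%:C -> H z (conjc z) = 0.
  move=> zr; rewrite /H conjcK -[conjc a + conjc z](raddfD (@conjc R)) mulN1r.
  rewrite !Re_conj Im_conj mmap_real hQ // addrC addKr //.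
have [b br qb] := slice_poly_neq0 a (fun b => conjc (F b)) Q0 (divr_gt0 r0 (ltr0n R 2)).
have rr : (r / 2)%:C = r%:C / 2 :> C by rewrite rmorphM fmorphV rmorph_nat.
exists (slice_poly Q (conjc b) (conjc (F b))) => // z za.
rewrite slice_polyE.
have := separated_polarization r0' sH H0 (z := z - a) (w := conjc (b - a)).
rewrite normcJ -rr => /(_ za br) <-; rewrite /H conjcK.
rewrite [a + (z - a)]addrC [a + (b - a)]addrC !subrK mulN1r.
by rewrite -[conjc a + _](raddfD (@conjc R)) [a + (b - a)]addrC subrK.
Qed.

End Algebraic.

(** * Linear combinations of algebraic functions *)

Section FunctionRing.
Local Open Scope complex_scope.
Variable K : numFieldType.

(** Polynomials act on functions through a map [pi]; below, [pi] retracts the plane onto a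
    disc, so that a relation known on the disc becomes an identity in the ring of functions on
    the whole plane. *)
Definition eval_along (pi : K -> K) (p : {poly K}) : K -> K := fun z => p.[pi z].
Definition value_at (z : K) (u : K -> K) : K := u z.

Lemma eval_along_is_zmod pi : zmod_morphism (eval_along pi).
Proof. by move=> p q; apply/funext => z; rewrite /eval_along hornerD hornerN. Qed.
Lemma eval_along_is_monoid pi : monoid_morphism (eval_along pi).
Proof.
by split=> [|p q]; apply/funext => z; rewrite /eval_along ?hornerC ?hornerM.
Qed.
HB.instance Definition _ pi := GRing.isZmodMorphism.Build {poly K} (K -> K) (eval_along pi)
  (eval_along_is_zmod pi).
HB.instance Definition _ pi := GRing.isMonoidMorphism.Build {poly K} (K -> K) (eval_along pi)
  (eval_along_is_monoid pi).

Lemma value_at_is_zmod z : zmod_morphism (value_at z).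
Proof. by []. Qed.
Lemma value_at_is_monoid z : monoid_morphism (value_at z).
Proof. by []. Qed.
HB.instance Definition _ z := GRing.isZmodMorphism.Build (K -> K) K (value_at z)
  (value_at_is_zmod z).
HB.instance Definition _ z := GRing.isMonoidMorphism.Build (K -> K) K (value_at z)
  (value_at_is_monoid z).

Lemma value_horner pi (p : {poly {poly K}}) (u : K -> K) z :
  (map_poly (eval_along pi) p).[u] z = p.[(u z)%:P].[pi z].
Proof.
rewrite -[LHS]/(value_at z _) -horner_map -map_poly_comp.
rewrite -[RHS]/(horner_eval (pi z) _) -horner_map /= /horner_eval hornerC.
by congr (_.[_]); apply: eq_map_poly.
Qed.

(** Evaluation at z of the outer variable only sees the value at z of the inner argument. *)
Lemma horner_inner (p : {poly {poly K}}) (r : {poly K}) z : p.[r].[z] = p.[r.[z]%:P].[z].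
Proof.
have E s : p.[s].[z] = (map_poly (horner_eval z) p).[s.[z]].
  by rewrite -[LHS]/(horner_eval z _) -horner_map.
by rewrite !E hornerC.
Qed.

Definition algebraic_on (V : K -> Prop) (F : K -> K) : Prop :=
  exists2 q : {poly {poly K}}, q != 0 & forall z, V z -> q.[(F z)%:P].[z] = 0.

(** Multiplying an algebraic function by the leading coefficient of its equation makes it
    integral over the polynomials. *)
Lemma algebraic_integral (V : K -> Prop) pi F :
  (forall z, V (pi z)) -> algebraic_on V F ->
  exists2 l : {poly K}, l != 0 &
    integralOver (eval_along pi) (fun z => l.[pi z] * F (pi z)).
Proof.
move=> Vpi [q0 q00 hq0].
(* The factor 'X makes the degree in the function positive. *)
pose q := q0 * 'X; have qn0 : q != 0 by rewrite mulf_neq0 // polyX_eq0.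
have hq z : V z -> q.[(F z)%:P].[z] = 0 by move=> Vz; rewrite !hornerE hq0 // mul0r.
pose n := (size q).-1; pose l := lead_coef q.
have sq : size q = n.+1 by rewrite /n prednK // lt0n size_poly_eq0.
have n1 : (0 < n)%N by rewrite /n size_mulX //= lt0n size_poly_eq0.
have l0 : l != 0 by rewrite lead_coef_eq0.
exists l => //.
pose p0 : {poly {poly K}} := \poly_(j < n) (q`_j * l ^+ (n.-1 - j)).
pose p := p0 + 'X^n.
have sp : (size p0 < size ('X^n : {poly {poly K}}))%N.
  by rewrite size_polyXn ltnS size_poly.
exists p.
  by rewrite monicE lead_coefDr // lead_coefXn.
apply/rootP/funext => z; rewrite value_horner.
rewrite hornerD hornerXn horner_poly hornerD horner_sum horner_exp hornerC.
have := hq _ (Vpi z); rewrite (horner_coef q) horner_sum sq big_ord_recr /= => e.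
transitivity (l.[pi z] ^+ n.-1 * (\sum_(i < n) (q`_i * (F (pi z))%:P ^+ i).[pi z] +
    (q`_n * (F (pi z))%:P ^+ n).[pi z])); last by rewrite e mulr0.
rewrite mulrDr mulr_sumr; congr (_ + _).
  apply: eq_bigr => j _; rewrite !hornerM !horner_exp !hornerC exprMn.
  have -> : l.[pi z] ^+ n.-1 = l.[pi z] ^+ (n.-1 - j) * l.[pi z] ^+ j.
    by rewrite -exprD subnK // -ltnS prednK.
  move: (q`_j).[pi z] (l.[pi z] ^+ (n.-1 - j)) (l.[pi z] ^+ j) (F (pi z) ^+ j) => a1 a2 a3 a4.
  by ring.
rewrite !hornerM !horner_exp !hornerC exprMn -[q`_n]/(lead_coef q) -/l.
by rewrite mulrA -exprSr prednK.
Qed.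

Lemma integral_algebraic (V : K -> Prop) pi F (l : {poly K}) :
  (forall z, V z -> pi z = z) -> l != 0 ->
  integralOver (eval_along pi) (fun z => l.[pi z] * F (pi z)) -> algebraic_on V F.
Proof.
move=> piV l0 [p pm /rootP rp].
have sl : size (l%:P * 'X) = 2%N by rewrite size_Cmul // size_polyX.
exists (p \Po (l%:P * 'X)); first by rewrite comp_poly2_eq0 // monic_neq0.
move=> z Vz; have := congr1 (fun u => u z) rp; rewrite value_horner /= piV //.
rewrite horner_comp hornerM hornerC hornerX => e.
by rewrite horner_inner hornerM hornerC e.
Qed.

(** Integral elements form a ring, and denominators can be cleared at the end: this avoids
    resultants. *)
Lemma algebraic_linear (V : K -> Prop) (a e1 e2 : K) F G : V a ->
  algebraic_on V F -> algebraic_on V G -> algebraic_on V (fun z => e1 * F z + e2 * G z).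
Proof.
move=> Va hF hG.
(* A retraction onto V: outside V, everything is evaluated at a. *)
pose pi z := if `[< V z >] then z else a.
have Vpi z : V (pi z) by rewrite /pi; case: ifP => // /asboolP.
have piV z : V z -> pi z = z by rewrite /pi => /asboolP ->.
have [l l0 iF] := algebraic_integral Vpi hF.
have [m m0 iG] := algebraic_integral Vpi hG.
apply: (@integral_algebraic V pi _ (l * m)) => //; first by rewrite mulf_neq0.
have := integral_add (integral_mul (integral_id (eval_along pi) (e1%:P * m)) iF)
  (integral_mul (integral_id (eval_along pi) (e2%:P * l)) iG).
congr (integralOver _ _); apply/funext => z.
transitivity ((e1%:P * m).[pi z] * (l.[pi z] * F (pi z)) +
  (e2%:P * l).[pi z] * (m.[pi z] * G (pi z))); first by [].
rewrite !hornerM !hornerC.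
by move: (l.[pi z]) (m.[pi z]) (F (pi z)) (G (pi z)) => ? ? ? ?; ring.
Qed.
End FunctionRing.

(** * Germs of complex Nash functions *)

Section PolyToMpoly.
Local Open Scope complex_scope.
Variable K : numFieldType.

Lemma poly2_nonroot (q : {poly {poly K}}) : q != 0 -> exists z t, q.[t%:P].[z] != 0.
Proof.
move=> q0; have [z hz] : exists z, (lead_coef q).[z] != 0.
  by apply: poly_nonroot; rewrite lead_coef_eq0.
have qz0 : map_poly (horner_eval z) q != 0.
  apply/eqP => /(congr1 (fun p : {poly K} => p`_(size q).-1)).
  by rewrite coef0 coef_map -lead_coefE => /eqP; apply/negP.
have [t ht] := poly_nonroot qz0; exists z, t; move: ht; congr (_ != 0).
by rewrite -[RHS]/(horner_eval z _) -horner_map /= /horner_eval hornerC.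
Qed.

(** Passage from iterated polynomials, suited to integrality, to polynomials in two variables. *)
Lemma mpoly_of_poly2 (q : {poly {poly K}}) : q != 0 ->
  exists2 P : mpoly (1 + 1) K, P != 0 &
    forall z t, meval (fun i => row_mx z%:M t%:M 0 i) P = q.[t%:P].[z].
Proof.
pose X (i : 'I_(1 + 1)) := mpolyX K (mnm1 i).
pose P := \sum_(j < size q) \sum_(i < size q`_j)
  (q`_j)`_i *: (X (lshift 1 ord0) ^+ i * X (rshift 1 ord0) ^+ j).
have ev z t : meval (fun i => row_mx z%:M t%:M 0 i) P = q.[t%:P].[z].
  rewrite rmorph_sum (horner_coef q) horner_sum; apply: eq_bigr => j _.
  rewrite rmorph_sum hornerM horner_exp hornerC (horner_coef q`_j) mulr_suml.
  apply: eq_bigr => i _; rewrite /= mevalZ rmorphM !rmorphXn /= !mevalXU.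
  by rewrite row_mxEl row_mxEr !mxE !mulr1n mulrA.
move=> /poly2_nonroot [z [t h]]; exists P => //.
by apply: contraNneq h => P0; rewrite -ev P0 meval0.
Qed.
End PolyToMpoly.

Section Germ.
Local Open Scope complex_scope.
Variable R : realType.
Local Notation C := (Cplx R).

(** The local content of being complex Nash: a power series expansion at [a], and one algebraic
    relation on a disc around [a]. *)
Definition nash_germ (F : C -> C) (a : C) : Prop :=
  exists r : R, [/\ 0 < r, has_power_series r%:C (fun z => F (a + z))
    & algebraic_on (fun z => `|z - a| < r%:C) F].

Lemma has_power_series_shrink (r s : R) (F : C -> C) : 0 < s -> s <= r ->
  has_power_series r%:C F -> has_power_series s%:C F.
Proof.
move=> s0 sr [a [M hF]].
have s0' : 0 < s%:C :> C by rewrite ltcR.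
have sr' : s%:C <= r%:C :> C by rewrite lecR.
exists a, M; split=> [n|n tau z zt ts].
  apply: le_trans (hF.1 n); apply: ler_sum => k _; rewrite ler_wpM2l //.
  by rewrite lerXn2r ?nnegrE ?(ltW s0') // ltW // (lt_le_trans s0').
apply: le_trans (hF.2 n tau z zt (le_trans ts sr')) _.
have t0 : 0 < tau by apply: le_lt_trans zt.
rewrite ler_wpM2l ?(power_series_ge0 hF) // lerXn2r ?nnegrE ?divr_ge0 ?(ltW t0) ?(ltW s0') //.
  by rewrite ltW // (lt_le_trans s0').
by rewrite ler_wpM2l ?(ltW t0) // lef_pV2 // posrE (lt_le_trans s0').
Qed.

Lemma nash_germ_linear (e1 e2 : C) (F G : C -> C) a : nash_germ F a -> nash_germ G a ->
  nash_germ (fun z => e1 * F z + e2 * G z) a.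
Proof.
move=> [r [r0 hF [q q0 hq]]] [s [s0 hG [p p0 hp]]].
pose t := Num.min r s; have t0 : 0 < t by rewrite lt_min r0.
have tr : t <= r by rewrite ge_min lexx.
have ts : t <= s by rewrite ge_min lexx orbT.
have t0' : 0 < t%:C :> C by rewrite ltcR.
exists t; split=> //.
  have [a1 [M1 h1]] := has_power_series_shrink t0 tr hF.
  have [a2 [M2 h2]] := has_power_series_shrink t0 ts hG.
  have := power_series_add t0' (power_series_scale e1 h1) (power_series_scale e2 h2).
  by eexists; eexists; eauto.
apply: (@algebraic_linear _ _ a); first by rewrite subrr normr0.
  by exists q => // z za; apply: hq; apply: lt_le_trans za _; rewrite lecR.
by exists p => // z za; apply: hp; apply: lt_le_trans za _; rewrite lecR.
Qed.

Lemma normc_real (x : R) : `|x%:C| = `|x|%:C :> C.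
Proof. by rewrite normc_def /= expr0n addr0 sqrtr_sqr. Qed.

Lemma ge0_realC (x : C) : 0 <= x -> exists2 y : R, 0 <= y & x = y%:C.
Proof. by case: x => a b; rewrite lecE /= => /andP[/eqP -> a0]; exists a. Qed.

Lemma sum_bmultinom1 (g : multinom 1 -> C) n :
  \sum_(nu : bmultinom 1 n) g nu = \sum_(k < n) g (mnm_muln (mnm1 ord0) k).
Proof.
rewrite big_bmultinom_degree; apply: eq_bigr => d _.
have dd : mdeg (mnm_muln (mnm1 (ord0 : 'I_1)) d) = d.
  by rewrite mdegE big_ord1 mulmnE mnm1E eqxx mul1n.
have lt : (mdeg (mnm_muln (mnm1 (ord0 : 'I_1)) d) < d.+1)%N by rewrite dd.
rewrite (big_pred1 (BMultinom lt)) // => nu; apply/eqP/eqP => [e|->//].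
apply/val_inj/mnmP => i /=; rewrite (ord1 i) mulmnE mnm1E eqxx mul1n.
by transitivity (mdeg nu); [rewrite mdegE big_ord1|exact: e].
Qed.

(** In one variable, multi-indices of total degree below n are the numbers below n. *)
Lemma power_series_analytic (F : C -> C) (r : R) (x : 'rV[C]_1) : 0 < r ->
  has_power_series r%:C (fun z => F (x 0 0 + z)) ->
  analytic_at (fun y : 'rV[C]_1 => F (y 0 0)) x.
Proof.
move=> r0 [al [M hF]].
have r0' : 0 < r%:C :> C by rewrite ltcR.
have [m m0 Mm] := ge0_realC (power_series_ge0 hF).
exists (fun nu => al (mdeg nu)), r%:C.
have dg k : mdeg (mnm_muln (mnm1 (ord0 : 'I_1)) k) = k.
  by rewrite mdegE big_ord1 mulmnE mnm1E eqxx mul1n.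
split=> //.
  pose S n := \sum_(k < n) complex.Re `|al k| * r ^+ k.
  have aR k : `|al k| = (complex.Re `|al k|)%:C.
    by have [y _ ->] := ge0_realC (normr_ge0 (al k)).
  have SE n : \sum_(nu : bmultinom 1 n) `|al (mdeg nu)| * r%:C ^+ mdeg nu = (S n)%:C.
    rewrite (sum_bmultinom1 (fun nu => `|al (mdeg nu)| * r%:C ^+ mdeg nu)).
    rewrite [RHS](rmorph_sum (real_complex R)); apply: eq_bigr => k _.
    by rewrite dg {1}aR rmorphM rmorphXn.
  have cS : cvgn S.
    apply: nondecreasing_is_cvgn.
      apply/nondecreasing_seqP => n; rewrite /S big_ord_recr lerDl.
      have [b b0 eb] := ge0_realC (normr_ge0 (al n)).
      rewrite (_ : complex.Re _ = b); last by have /(congr1 (@complex.Re R)) := eb.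
      by rewrite mulr_ge0 ?exprn_ge0 ?(ltW r0).
    exists m => _ [n _ <-]; rewrite -lecR -SE -Mm.
    rewrite (sum_bmultinom1 (fun nu => `|al (mdeg nu)| * r%:C ^+ mdeg nu)).
    by under eq_bigr do rewrite dg; exact: hF.1.
  apply/cvg_ex; exists (limn S)%:C; under eq_fun do rewrite SE.
  apply/cvgrPdist_lt => eps eps0.
  have [e e0 ee] := ge0_realC (ltW eps0); move: eps0; rewrite ee ltcR => {}e0.
  have := cS => /cvgrPdist_lt /(_ _ e0); apply: filterS => n.
  by rewrite -rmorphB normc_real ltcR.
move=> y /(_ ord0) yx; pose z := y 0 0 - x 0 0.
have zr : `|z| < r%:C by exact: yx.
have [z1 z10 zz] := ge0_realC (normr_ge0 z).
pose t := (z1 + r) / 2.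
have z1r : z1 < r by rewrite -ltcR -zz.
have zt : `|z| < t%:C by rewrite zz ltcR /t; lra.
have tr : t < r by rewrite /t; lra.
have t0 : 0 < t by rewrite /t; lra.
have E n : \sum_(nu : bmultinom 1 n) al (mdeg nu) *
   \prod_(i < 1) (y 0 i - x 0 i) ^+ fun_of_multinom nu i = taylor_sum al n z.
  rewrite (sum_bmultinom1 (fun nu => al (mdeg nu) * \prod_(i < 1) (y 0 i - x 0 i) ^+ fun_of_multinom nu i)).
  by apply: eq_bigr => k _; rewrite dg big_ord1 mulmnE mnm1E eqxx mul1n.
under eq_fun do rewrite E.
apply/cvgrPdist_lt => eps eps0.
have [e e0 ee] := ge0_realC (ltW eps0); move: eps0; rewrite ee ltcR => {}e0.
have q0 : 0 <= t / r by rewrite divr_ge0 // ltW.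
have q1 : `|t / r| < 1 by rewrite (ger0_norm q0) ltr_pdivrMr // mul1r.
have : (fun n => m * (t / r) ^+ n) @ \oo --> m * 0.
  by apply: cvgM; [exact: cvg_cst|exact: cvg_expr].
rewrite mulr0 => /cvgrPdist_lt /(_ _ e0); apply: filterS => n.
rewrite sub0r normrN ger0_norm; last by rewrite mulr_ge0 ?exprn_ge0.
move=> h; have := hF.2 n t%:C z zt; rewrite lecR => /(_ (ltW tr)).
have xz : x 0 0 + z = y 0 0 by rewrite /z addrC subrK.
rewrite xz => h2; apply: le_lt_trans h2 _.
by rewrite Mm -fmorphV -rmorphM -rmorphXn -rmorphM ltcR.
Qed.

(** The relation at a point x holds on a disc around x, while analyticity at the other points of
    this disc comes from their own germs. *)
Lemma nash_germ_complex_nash (D : set C) (F : C -> C) : open D ->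
  (forall a, D a -> nash_germ F a) -> complex_nash_on D F.
Proof.
move=> oD hF x /= Dx.
have [r [r0 _ [q q0 hq]]] := hF _ Dx.
have [e0 /= e00 eD] : exists2 e, 0 < e & forall z, `|z - x 0 0| < e -> D z.
  have := open_nbhs_nbhs (conj oD Dx).
  move=> /nbhs_normP [e /= e0 he]; exists e => // z ze; apply: he.
  by rewrite /ball_ /= distrC.
have [e _ ee] := ge0_realC (ltW e00); move: e00 eD; rewrite ee ltcR => e00 eD.
pose s := Num.min r e.
have s0 : 0 < s by rewrite lt_min r0.
have se : s <= e by rewrite ge_min lexx orbT.
have sr : s <= r by rewrite ge_min lexx.
exists [set y : 'rV[C]_1 | `|y 0 0 - x 0 0| < s%:C]; split.
- apply: (@open_comp _ _ (fun y : 'rV[C]_1 => y 0 0) [set z | `|z - x 0 0| < s%:C]).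
    by move=> y _; apply: coord_continuous.
  rewrite (_ : [set z | _] = ball (x 0 0) s%:C); first by apply: ball_open; rewrite ltcR.
  by apply/funext => z; rewrite /ball /= /ball_ /= distrC.
- by rewrite /= subrr normr0 ltcR.
- by move=> y /= yx; apply: eD; apply: lt_le_trans yx _; rewrite lecR.
- move=> y /= yx; have Dy : D (y 0 0) by apply: eD; apply: lt_le_trans yx _; rewrite lecR.
  by have [r' [r'0 hr' _]] := hF _ Dy; apply: power_series_analytic r'0 hr'.
have [P P0 hP] := mpoly_of_poly2 q0; exists P => // y /= yx.
rewrite -(hq (y 0 0)); last by apply: lt_le_trans yx _; rewrite lecR.
rewrite -hP; apply: meval_eq => i.
by congr (row_mx _ _ _ _); apply/matrixP => j k; rewrite !ord1 !mxE eqxx mulr1n.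
Qed.
End Germ.

(** * Germs of holomorphic functions whose real part is real Nash *)

Section CR.
Local Open Scope complex_scope.
Variable R : realType.
Local Notation C := (Cplx R).

(** Conjugating the coefficients of the series and of the relation. *)
Lemma nash_germ_conj (F : C -> C) (a : C) :
  nash_germ F (conjc a) -> nash_germ (fun z => conjc (F (conjc z))) a.
Proof.
move=> [r [r0 hF [q q0 hq]]]; have r0' : 0 < r%:C :> C by rewrite ltcR.
exists r; split=> //.
  have := has_power_series_conj hF; congr (has_power_series _ _); apply/funext => z.
  by congr (conjc (F _)); rewrite [RHS](raddfD (@conjc R)).
exists (map_poly (map_poly (@conjc R)) q).
  by rewrite map_poly_eq0_id0 // map_poly_eq0 lead_coef_eq0.
move=> z za; have e (p : {poly C}) (y : C) : (map_poly (@conjc R) p).[conjc y] = conjc p.[y].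
  exact: horner_map.
have := hq (conjc z); rewrite -(raddfB (@conjc R)) normcJ => /(_ za).
move=> /(congr1 (@conjc R)); rewrite -e conjcK [RHS](raddf0 (@conjc R)) => <-.
have -> : map_poly (@conjc R) q.[(F (conjc z))%:P] =
    (map_poly (map_poly (@conjc R)) q).[map_poly (@conjc R) (F (conjc z))%:P].
  by rewrite horner_map.
by rewrite map_polyC.
Qed.

Lemma real_series_shrink (r s M : R) c (u : R -> R -> R) : 0 < s -> s <= r ->
  real_series r M c u -> real_series s M c u.
Proof.
move=> s0 sr [hM hu]; split=> [n|x y xs ys]; last by apply: hu; apply: lt_le_trans sr.
apply: le_trans (hM n); apply: ler_sum => d _; rewrite ler_wpM2l ?sumr_ge0 //.
by rewrite lerXn2r // nnegrE ltW // (lt_le_trans s0).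
Qed.

Lemma is_derive_translate (f : R -> R) (x0 x p : R) :
  is_derive (x0 + x) 1 f p -> is_derive x 1 (fun t => f (x0 + t)) p.
Proof.
move=> df.
have dg : is_derive x 1 (fun t : R => x0 + t) (0 + 1) by apply: is_deriveD.
by have := is_derive1_comp df dg; rewrite add0r mulr1.
Qed.

Definition cauchy_riemann_at (u v : C -> R) (z : C) : Prop :=
  exists p q : R,
    [/\ is_derive (complex.Re z) 1 (real_line u z) p, is_derive (complex.Im z) 1 (imag_line u z) q,
        is_derive (complex.Im z) 1 (imag_line v z) p & is_derive (complex.Re z) 1 (real_line v z) (- q)].

(** The analytic and the algebraic halves meet here: u is the restriction to a coordinate plane
    of a real Nash function, so u + iv has a power series and an algebraic equation. *)
Lemma cauchy_riemann_nash_germ (N : nat) (i0 i1 : 'I_N) (V : set 'rV[R]_N) h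
    (D : set C) (u v : C -> R) (a : C) :
  i0 != i1 -> nash_on V h -> open D -> D a ->
  V (plane_pt i0 i1 (complex.Re a) (complex.Im a)) ->
  (forall z, D z -> V (plane_pt i0 i1 (complex.Re z) (complex.Im z)) ->
     h (plane_pt i0 i1 (complex.Re z) (complex.Im z)) = u z) ->
  (forall z, D z -> cauchy_riemann_at u v z) ->
  nash_germ (fun z => u z +i* v z) a.
Proof.
move=> i01 hN oD Da Va hu hCR.
have [W [oW Wa WV anW [P P0 hP]]] := hN _ Va.
have [Q Q0 hQ] := reduce_to_plane i0 i1 P0.
have := anW _ Wa => /(analytic_plane i01) [r [M [c [r0 hs]]]].
pose x0 := complex.Re a; pose y0 := complex.Im a.
have [e1 e10 he1] : exists2 e : R, 0 < e & forall x y : R, `|x| < e -> `|y| < e -> D (Complex (x0 + x) (y0 + y)).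
  have := open_nbhs_nbhs (conj oD Da) => /nbhs_normP [e /= e0 he].
  have [e' _ ee] := ge0_realC (ltW e0); move: e0 he; rewrite ee ltcR => e0 he.
  exists (e' / 2) => [|x y xe ye]; first by rewrite divr_gt0.
  apply: he; rewrite /ball_ /= distrC; apply: le_lt_trans (norm_le_ReIm _) _.
  rewrite !raddfB /= -/x0 -/y0 [x0 + x]addrC [y0 + y]addrC !addrK ltcR.
  by rewrite [ltRHS](splitr e') ltrD.
have [e2 e20 he2] : exists2 e : R, 0 < e & forall x y : R, `|x| < e -> `|y| < e -> W (plane_pt i0 i1 (x0 + x) (y0 + y)).
  have := open_nbhs_nbhs (conj oW Wa) => /nbhs_ballP [e /= e0 he].
  exists e => // x y xe ye; apply: he; split=> // j k; rewrite /ball /= !mxE /x0 /y0.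
  case: ifP => _; first by rewrite opprD addNKr normrN.
  by case: ifP => _; [rewrite opprD addNKr normrN|rewrite subrr normr0].
pose s := Num.min r (Num.min e1 e2).
have s0 : 0 < s by rewrite !lt_min r0 e10 e20.
have sr : s <= r by rewrite ge_min lexx.
have se1 : s <= e1 by rewrite !ge_min lexx orbT.
have se2 : s <= e2 by rewrite !ge_min lexx !orbT.
pose U x y := u (Complex (x0 + x) (y0 + y)); pose V1 x y := v (Complex (x0 + x) (y0 + y)).
have inD x y : `|x| < s -> `|y| < s -> D (Complex (x0 + x) (y0 + y)).
  by move=> xs ys; apply: he1; [apply: lt_le_trans se1|apply: lt_le_trans se1].
have inW x y : `|x| < s -> `|y| < s -> W (plane_pt i0 i1 (x0 + x) (y0 + y)).
  by move=> xs ys; apply: he2; [apply: lt_le_trans se2|apply: lt_le_trans se2].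
have hU x y : `|x| < s -> `|y| < s -> h (plane_pt i0 i1 (x0 + x) (y0 + y)) = U x y.
  move=> xs ys; apply: (hu (Complex (x0 + x) (y0 + y))); first exact: inD.
  by apply: WV; apply: inW.
have hsU : real_series s M c U.
  have [h1 h2] := real_series_shrink s0 sr hs; split=> // x y xs ys.
  by rewrite -hU //; apply: h2.
have [p hp] : exists p : C -> R, forall z, D z -> exists q : R,
    [/\ is_derive (complex.Re z) 1 (real_line u z) (p z), is_derive (complex.Im z) 1 (imag_line u z) q,
        is_derive (complex.Im z) 1 (imag_line v z) (p z) & is_derive (complex.Re z) 1 (real_line v z) (- q)].
  exists (fun z => derive1 (real_line u z) (complex.Re z)) => z Dz.
  have [p [q [h1 h2 h3 h4]]] := hCR z Dz; exists q.
  have -> : derive1 (real_line u z) (complex.Re z) = p by rewrite derive1E; apply: derive_val.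
  by split.
have [q hq] : exists q : C -> R, forall z, D z ->
    [/\ is_derive (complex.Re z) 1 (real_line u z) (p z), is_derive (complex.Im z) 1 (imag_line u z) (q z),
        is_derive (complex.Im z) 1 (imag_line v z) (p z) & is_derive (complex.Re z) 1 (real_line v z) (- q z)].
  exists (fun z => derive1 (imag_line u z) (complex.Im z)) => z Dz.
  have [q [h1 h2 h3 h4]] := hp z Dz.
  have -> : derive1 (imag_line u z) (complex.Im z) = q by rewrite derive1E; apply: derive_val.
  by split.
have CRU (x y : R) : `|x| < s -> `|y| < s ->
    [/\ is_derive x 1 (U^~ y) (p (Complex (x0 + x) (y0 + y))), is_derive y 1 (U x) (q (Complex (x0 + x) (y0 + y))),
        is_derive y 1 (V1 x) (p (Complex (x0 + x) (y0 + y))) & is_derive x 1 (V1^~ y) (- q (Complex (x0 + x) (y0 + y)))].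
  move=> xs ys; have [h1 h2 h3 h4] := hq _ (inD _ _ xs ys).
  by split; [exact: (is_derive_translate h1)|exact: (is_derive_translate h2)|
    exact: (is_derive_translate h3)|exact: (is_derive_translate h4)].
have [al [N' hal]] := @holomorphic_power_series R s M c U V1
  (fun x y => p (Complex (x0 + x) (y0 + y))) (fun x y => q (Complex (x0 + x) (y0 + y))) s0 hsU CRU.
pose F z := u z +i* v z.
have psF : has_power_series (s / 2)%:C (fun z => F (a + z)).
  exists al, N'; move: hal; congr (power_series _ _ _ _); apply/funext => z.
  by rewrite /F (_ : a + z = Complex (x0 + complex.Re z) (y0 + complex.Im z)) // /x0 /y0; case: (a) (z) => [? ?] [? ?].
have s20 : 0 < s / 2 by rewrite divr_gt0.
have ss : s / 2 <= s by rewrite ler_pdivrMr // ler_peMr ?(ltW s0) // ler1n.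
have rel z : `|z - a| < (s / 2)%:C -> meval (triple (complex.Re z) (complex.Im z) (complex.Re (F z))) Q = 0.
  move=> za; have zx : `|complex.Re z - x0| < s.
    by rewrite -ltcR -raddfB; apply: le_lt_trans (normc_ge_Re _) (lt_le_trans za _); rewrite lecR.
  have zy : `|complex.Im z - y0| < s.
    by rewrite -ltcR -raddfB; apply: le_lt_trans (norm_ge_Im _) (lt_le_trans za _); rewrite lecR.
  have ez : Complex (x0 + (complex.Re z - x0)) (y0 + (complex.Im z - y0)) = z.
    by rewrite ![_ + (_ - _)]addrC !subrK; case: (z).
  have := hU _ _ zx zy; rewrite /U ez ![_ + (_ - _)]addrC !subrK => e.
  rewrite /F /= -e; apply: (hQ W h oW anW hP).
  by have := inW _ _ zx zy; rewrite ![_ + (_ - _)]addrC !subrK.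
have [q' q0 hq'] := holomorphic_algebraic Q0 s20 psF rel.
exists (s / 2 / 2); split; first by rewrite divr_gt0.
  apply: has_power_series_shrink psF; first by rewrite divr_gt0.
  by rewrite ler_pdivrMr // ler_peMr ?(ltW s20) // ler1n.
by exists q'.
Qed.
End CR.

(** * Cartan algebras in coordinates *)

Section SymDiff.
Local Open Scope complex_scope.
Variable n : nat.
Implicit Types K H L : {set 'I_n}.

Lemma symdiffA K H L : setsymdiff K (setsymdiff H L) = setsymdiff (setsymdiff K H) L.
Proof.
by apply/setP => i; rewrite !inE; case: (i \in K); case: (i \in H); case: (i \in L).
Qed.
Lemma symdiffC K H : setsymdiff K H = setsymdiff H K.
Proof. by apply/setP => i; rewrite !inE; case: (i \in K); case: (i \in H). Qed.
Lemma symdiffK K : setsymdiff K K = finset.set0.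
Proof. by apply/setP => i; rewrite !inE; case: (i \in K). Qed.
Lemma symdiff0 K : setsymdiff K finset.set0 = K.
Proof. by apply/setP => i; rewrite !inE; case: (i \in K). Qed.
Lemma symdiffKK K H : setsymdiff K (setsymdiff K H) = H.
Proof. by rewrite symdiffA symdiffK symdiffC symdiff0. Qed.
Lemma in_symdiff K H i : (i \in setsymdiff K H) = (i \in K) (+) (i \in H).
Proof. by rewrite !inE; case: (i \in K); case: (i \in H). Qed.
End SymDiff.

Section Cartan.
Local Open Scope complex_scope.
Variables (R : realType) (n : nat) (A : cartan_star_algebra R n).
Local Notation "x ** y" := (ca_mul x y) (at level 40, left associativity).
Local Notation e := (ca_e A).
Local Notation sg := (ca_sigma A).
Local Notation C := (Cplx R).
Implicit Types K H L : {set 'I_n}.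

Lemma ca_mulDl (x y z : A) : (x + y) ** z = x ** z + y ** z.
Proof. by have := ca_mul_linearl (c := A) z 1 x y; rewrite !scale1r. Qed.
Lemma ca_mul0l (z : A) : 0 ** z = 0.
Proof. by apply: (addIr (0 ** z)); rewrite -ca_mulDl !add0r. Qed.
Lemma ca_mulZl a (x z : A) : (a *: x) ** z = a *: (x ** z).
Proof. by have := ca_mul_linearl (c := A) z a x 0; rewrite ca_mul0l !addr0. Qed.
Lemma ca_mulDr (x y z : A) : z ** (x + y) = z ** x + z ** y.
Proof. by have := ca_mul_linearr (c := A) z 1 x y; rewrite !scale1r. Qed.
Lemma ca_mul0r (z : A) : z ** 0 = 0.
Proof. by apply: (addIr (z ** 0)); rewrite -ca_mulDr !add0r. Qed.
Lemma ca_mulZr a (x z : A) : z ** (a *: x) = a *: (z ** x).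
Proof. by have := ca_mul_linearr (c := A) z a x 0; rewrite ca_mul0r !addr0. Qed.
Lemma ca_mulNN (x z : A) : (- x) ** (- z) = x ** z.
Proof. by rewrite -scaleN1r -[- z]scaleN1r ca_mulZl ca_mulZr scalerA mulrNN mulr1 scale1r. Qed.
Lemma ca_mul_suml I (r : seq I) (F : I -> A) z : (\sum_(i <- r) F i) ** z = \sum_(i <- r) F i ** z.
Proof. by elim: r => [|i r IH]; rewrite ?big_nil ?ca_mul0l // !big_cons ca_mulDl IH. Qed.
Lemma ca_mul_sumr I (r : seq I) (F : I -> A) z : z ** (\sum_(i <- r) F i) = \sum_(i <- r) z ** F i.
Proof. by elim: r => [|i r IH]; rewrite ?big_nil ?ca_mul0r // !big_cons ca_mulDr IH. Qed.

Lemma csa_conjZ a (x : A) : csa_conj (a *: x) = a *: csa_conj x.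
Proof.
have c0 : csa_conj (0 : A) = 0.
  have := csa_conj_linear (c := A) 1 0 0; rewrite !scale1r addr0 => h.
  by apply: (addIr (csa_conj (0 : A))); rewrite add0r -h.
by have := csa_conj_linear (c := A) a x 0; rewrite c0 !addr0.
Qed.
Lemma csa_conjD (x y : A) : csa_conj (x + y) = csa_conj x + csa_conj y.
Proof. by have := csa_conj_linear (c := A) 1 x y; rewrite !scale1r. Qed.
Lemma csa_conjN (x : A) : csa_conj (- x) = - csa_conj x.
Proof. by rewrite -scaleN1r csa_conjZ scaleN1r. Qed.

Lemma component_is_linear L : linear (component (A := A) L).
Proof. by move=> a x y; rewrite /component /coords !mxE linearP. Qed.
Lemma componentD L (x y : A) : component L (x + y) = component L x + component L y.
Proof. by have := component_is_linear L 1 x y; rewrite !scale1r. Qed.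
Lemma component0 L : component L (0 : A) = 0.
Proof. by apply: (addIr (component L (0 : A))); rewrite -componentD !add0r. Qed.
Lemma componentZ L a (x : A) : component L (a *: x) = a * component L x.
Proof. by have := component_is_linear L a x 0; rewrite component0 !addr0. Qed.
Lemma componentN L (x : A) : component L (- x) = - component L x.
Proof. by rewrite -scaleN1r componentZ mulN1r. Qed.
Lemma component_sum L I (r : seq I) (F : I -> A) :
  component L (\sum_(i <- r) F i) = \sum_(i <- r) component L (F i).
Proof. by elim: r => [|i r IH]; rewrite ?big_nil ?component0 // !big_cons componentD IH. Qed.

Lemma component_e L H : component L (e H) = (H == L)%:R.
Proof.
rewrite /component /coords mxE.
have fr := basis_free (ca_e_basis A).
have -> : e H = (codom_tuple e)`_(enum_rank H).
  by rewrite /= nth_codom enum_rankK.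
by rewrite coord_free // (inj_eq enum_rank_inj).
Qed.

Lemma component_expand (x : A) : x = \sum_H component H x *: e H.
Proof.
rewrite {1}(coord_basis (X := codom_tuple e) (ca_e_basis A) (memvf x)).
rewrite (reindex enum_rank); last exact/onW_bij/enum_rank_bij.
apply: eq_bigr => H _; rewrite /component /coords mxE; congr (_ *: _).
by rewrite /= nth_codom enum_rankK.
Qed.

Lemma component_ext (x y : A) : (forall L, component L x = component L y) -> x = y.
Proof.
by move=> h; rewrite (component_expand x) (component_expand y); apply: eq_bigr => H _; rewrite h.
Qed.

(** Left multiplication by e_K permutes the basis, up to signs. *)
Lemma component_mul_e K L (x : A) :
  component L (e K ** x) = sg K (setsymdiff K L) * component (setsymdiff K L) x.
Proof.
rewrite {1}(component_expand x) ca_mul_sumr component_sum.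
rewrite (bigD1 (setsymdiff K L)) //= big1 => [|H HL].
  by rewrite ca_mulZr ca_mul_e !componentZ component_e symdiffKK eqxx addr0 mulr1 mulrC.
rewrite ca_mulZr ca_mul_e !componentZ component_e (_ : _ == L = false) ?mulr0 //.
by apply/negbTE; apply: contra HL => /eqP <-; rewrite symdiffKK.
Qed.

(** By induction on the size of K: e_K is, up to sign, a product of generators, each of which is fixed or
    negated, and reversing the product only changes its sign. *)
Lemma conj_e K : csa_conj (e K) = e K \/ csa_conj (e K) = - e K.
Proof.
move: {2}#|K| (leqnn #|K|) => m; elim: m K => [|m IH] K.
  rewrite leqn0 cards_eq0 => /eqP ->; left.
  by have := csa_conj_real A 1; rewrite !scale1r.
have [->|[k kK]] := set_0Vmem K.
  by move=> _; left; have := csa_conj_real A 1; rewrite !scale1r.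
rewrite (cardsD1 k) kK add1n ltnS => /IH IHK.
have sd : setsymdiff [set k]%SET (K :\ k)%SET = K.
  apply/setP => i; rewrite in_symdiff !inE; case: eqP => [->|]; by rewrite ?kK.
have m1 := ca_mul_e A [set k]%SET (K :\ k)%SET; rewrite sd in m1.
have m2 := ca_mul_e A (K :\ k)%SET [set k]%SET; rewrite symdiffC sd in m2.
have eK : e K = sg [set k]%SET (K :\ k)%SET *: (e [set k]%SET ** e (K :\ k)%SET).
  rewrite m1 scalerA; case: (ca_sigma_pm1 A [set k]%SET (K :\ k)%SET) => ->.
    by rewrite mulrNN mulr1 scale1r.
  by rewrite mulr1 scale1r.
rewrite {1 3}eK csa_conjZ csa_conjM.
case: IHK => ->; case: (csa_conj_e A k) => ->;
 rewrite -1?scaleN1r -?[- e [set k]%SET]scaleN1r ?ca_mulZl ?ca_mulZr m2;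
 case: (ca_sigma_pm1 A [set k]%SET (K :\ k)%SET) => ->;
 case: (ca_sigma_pm1 A (K :\ k)%SET [set k]%SET) => ->;
 rewrite !(scaleN1r, scale1r, opprK); by [left|right].
Qed.

Lemma component_conj K (x : A) :
  component K (csa_conj x) = component K x * component K (csa_conj (e K)).
Proof.
have conj_sum I (r : seq I) (F : I -> A) :
    csa_conj (\sum_(i <- r) F i) = \sum_(i <- r) csa_conj (F i).
  elim: r => [|i r IH]; last by rewrite !big_cons csa_conjD IH.
  by rewrite !big_nil -[in LHS](scale0r (e K)) csa_conjZ scale0r.
rewrite {1}(component_expand x) conj_sum component_sum (bigD1 K) //= big1 => [|H HK].
  by rewrite csa_conjZ componentZ addr0.
rewrite csa_conjZ componentZ; case: (conj_e H) => ->;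
  by rewrite ?componentN component_e (negbTE HK) ?oppr0 mulr0.
Qed.

Lemma symdiff_unit K L M : imaginary_units (e L ** e M) -> K = setsymdiff L M ->
  imaginary_units (e K).
Proof.
move=> h ->; move: h; rewrite ca_mul_e; case: (ca_sigma_pm1 A L M) => ->.
  rewrite scaleN1r => -[h1 h2]; split.
    by apply: oppr_inj; rewrite -csa_conjN h1.
  by rewrite -h2 ca_mulNN.
by rewrite scale1r.
Qed.

Lemma unit_symdiff K L M : imaginary_units (e K) -> K = setsymdiff L M ->
  imaginary_units (e L ** e M).
Proof.
move=> h eK; move: h; rewrite eK ca_mul_e; case: (ca_sigma_pm1 A L M) => ->.
  rewrite scaleN1r => -[h1 h2]; split; first by rewrite csa_conjN h1.
  by rewrite ca_mulNN.
by rewrite scale1r.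
Qed.

(** If no e_K were a unit, all the e_K occurring in J would have square 1, and the
    coefficient of 1 in J J would be a sum of squares instead of -1. *)
Lemma exists_basis_unit (J : A) : imaginary_units J -> exists K, imaginary_units (e K).
Proof.
move=> [Jc JJ]; apply: contrapT => /forallNP h.
have : component finset.set0 (J ** J) = - 1.
  by rewrite JJ componentN /ca_one component_e eqxx.
rewrite {1}(component_expand J) ca_mul_suml component_sum.
have pos K : 0 <= component finset.set0 ((component K J *: e K) ** J).
  rewrite ca_mulZl componentZ component_mul_e symdiff0.
  case: (ca_sigma_pm1 A K K) => s; last first.
    by rewrite s mul1r -expr2 sqr_ge0.
  case: (conj_e K) => cK.
    suff -> : component K J = 0 by rewrite mul0r.
    have := component_conj K J; rewrite Jc cK componentN component_e eqxx mulr1.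
    by move/eqP; rewrite eq_sym -addr_eq0 -mulr2n mulrn_eq0 /= => /eqP.
  exfalso; apply: (h K); split => //.
  by rewrite ca_mul_e s symdiffK scaleN1r.
have S0 : 0 <= \sum_K component finset.set0 ((component K J *: e K) ** J).
  by apply: sumr_ge0 => K _; apply: pos.
by move=> E; move: S0; rewrite E oppr_ge0 ler10.
Qed.

End Cartan.

(** * Components of a slice regular function *)

Section Determining.
Local Open Scope complex_scope.
Variables (R : realType) (n : nat) (A : cartan_star_algebra R n).
Local Notation "x ** y" := (ca_mul x y) (at level 40, left associativity).
Local Notation e := (ca_e A).
Local Notation sg := (ca_sigma A).
Local Notation C := (Cplx R).
Implicit Types K H L : {set 'I_n}.

Lemma unit_neq0 K : imaginary_units (e K) -> K != finset.set0.
Proof.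
move=> [_ h]; apply/eqP => K0; move: h; rewrite K0 ca_mul_e symdiffK ca_sigma0l scale1r /ca_one.
move=> /(congr1 (component finset.set0)); rewrite componentN component_e eqxx => /eqP.
by rewrite -addr_eq0 -mulr2n pnatr_eq0.
Qed.

(** The slice of a basis unit is a coordinate plane of A. *)
Lemma coords_slice_embed K (z : C) : K != finset.set0 ->
  coords (slice_embed (e K) z : A) =
  plane_pt (enum_rank finset.set0) (enum_rank K) (complex.Re z) (complex.Im z).
Proof.
move=> K0; apply/matrixP => i0 i; rewrite (ord1 i0) [RHS]mxE.
have -> : coords (slice_embed (e K) z : A) 0 i = component (enum_val i) (slice_embed (e K) z : A).
  by rewrite /component enum_valK.
rewrite /slice_embed componentD !componentZ /ca_one !component_e.
have E H : (i == enum_rank H) = (H == enum_val i).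
  by apply/eqP/eqP => [->|->]; rewrite ?enum_rankK ?enum_valK.
rewrite !E; case: eqP => [e0|_]; case: eqP => [e1|_]; rewrite ?(mulr0, mulr1, add0r, addr0) //.
by move: K0; rewrite e1 e0 eqxx.
Qed.

(** The function F_L = component_L F1 + i component_L F2. *)
Definition component_pair (F1 F2 : C -> A) L (z : C) : C :=
  component L (F1 z) +i* component L (F2 z).

Section Stem.
Variables (D : set C) (F1 F2 : C -> A) (f : A -> A).
Hypotheses (oD : open D) (cD : forall z : C, D z -> D (conjc z)).
Hypotheses (stemF : stem D F1 F2) (indF : induces D F1 F2 f).
Hypothesis C1F : forall K, C1_on D (component K \o F1) /\ C1_on D (component K \o F2).
Hypothesis CRF : forall z, D z ->
  D_alpha F1 z - D_beta F2 z = 0 /\ D_alpha F2 z + D_beta F1 z = 0.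

Lemma component_D_alpha L (F : C -> A) z : component L (D_alpha F z) = d_alpha (component L \o F) z.
Proof.
rewrite /D_alpha component_sum (bigD1 L) //= big1 => [|H HL].
  by rewrite componentZ component_e eqxx mulr1 addr0.
by rewrite componentZ component_e (negbTE HL) mulr0.
Qed.

Lemma component_D_beta L (F : C -> A) z : component L (D_beta F z) = d_beta (component L \o F) z.
Proof.
rewrite /D_beta component_sum (bigD1 L) //= big1 => [|H HL].
  by rewrite componentZ component_e eqxx mulr1 addr0.
by rewrite componentZ component_e (negbTE HL) mulr0.
Qed.

(** For s real, F_L - i s F_M has real part component_L F1 + s component_M F2. *)
Lemma cauchy_riemann_components L M (s : R) z : D z ->
  cauchy_riemann_at (fun z => component L (F1 z) + s * component M (F2 z))
    (fun z => component L (F2 z) - s * component M (F1 z)) z.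
Proof.
move=> Dz; have [E1 E2] := CRF Dz.
have cr1 K : d_alpha (component K \o F1) z = d_beta (component K \o F2) z.
  apply/eqP; rewrite -subr_eq0 -component_D_alpha -component_D_beta -componentN -componentD E1.
  by rewrite component0.
have cr2 K : d_alpha (component K \o F2) z = - d_beta (component K \o F1) z.
  apply/eqP; rewrite -addr_eq0 -component_D_alpha -component_D_beta -componentD E2.
  by rewrite component0.
have dr (u : C -> R) : C1_on D u -> is_derive (complex.Re z) 1 (real_line u z) (d_alpha u z).
  by move=> /(_ _ Dz) [h _ _ _]; rewrite /d_alpha derive1E; apply: derivableP.
have di (u : C -> R) : C1_on D u -> is_derive (complex.Im z) 1 (imag_line u z) (d_beta u z).
  by move=> /(_ _ Dz) [_ h _ _]; rewrite /d_beta derive1E; apply: derivableP.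
exists (d_alpha (component L \o F1) z + s * d_alpha (component M \o F2) z),
  (d_beta (component L \o F1) z + s * d_beta (component M \o F2) z).
have [[L1 L2] [M1 M2]] := (C1F L, C1F M); split.
- exact: (is_deriveD (dr _ L1) (is_deriveZ s (dr _ M2))).
- exact: (is_deriveD (di _ L1) (is_deriveZ s (di _ M2))).
- apply: is_derive_eq (is_deriveB (di _ L2) (is_deriveZ s (di _ M1))) _.
  by rewrite cr1 cr2 mulrN.
apply: is_derive_eq (is_deriveB (dr _ L2) (is_deriveZ s (dr _ M1))) _.
by rewrite cr1 cr2 opprD.
Qed.

Lemma nash_germ_ext (F G : C -> C) a : D a -> (forall z, D z -> F z = G z) ->
  nash_germ F a -> nash_germ G a.
Proof.
move=> Da FG [r [r0 hF [q q0 hq]]].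
have := open_nbhs_nbhs (conj oD Da) => /nbhs_normP [e' /= e0 he].
have [t _ ee] := ge0_realC (ltW e0); move: e0 he; rewrite ee ltcR => t0 he.
have inD z : `|z - a| < t%:C -> D z.
  by move=> za; apply: he; rewrite /ball_ /= distrC.
pose s := Num.min r t; have s0 : 0 < s by rewrite lt_min r0.
have sr : s <= r by rewrite ge_min lexx.
have st : s <= t by rewrite ge_min lexx orbT.
exists s; split=> //.
  have [al [M hal]] := has_power_series_shrink s0 sr hF; exists al, M; split=> [|k tau z zt ts].
    exact: hal.1.
  rewrite -FG; first exact: hal.2.
  apply: inD; rewrite addrAC subrr add0r; apply: lt_le_trans zt (le_trans ts _).
  by rewrite lecR.
exists q => // z za; rewrite -FG; last by apply: inD; apply: lt_le_trans za _; rewrite lecR.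
by apply: hq; apply: lt_le_trans za _; rewrite lecR.
Qed.

(** The component of f on the slice of e_K is the real part of Phi = F_L - i s F_M, where s is a sign.
    The functions F_L and F_M are linear combinations of Phi and of its reflection, which is
    F_L + i s F_M by the symmetry of the stem function. *)
Lemma nash_component_germs K L a : imaginary_units (e K) ->
  real_nash_on (Omega (A:=A) D) (fun x => component L (f x)) -> D a ->
  nash_germ (component_pair F1 F2 L) a /\
  nash_germ (component_pair F1 F2 (setsymdiff K L)) a.
Proof.
move=> uK nL Da; have K0 := unit_neq0 uK.
pose s := sg K (setsymdiff K L); pose M := setsymdiff K L.
pose Phi (z : C) : C := (component L (F1 z) + s * component M (F2 z)) +i*
  (component L (F2 z) - s * component M (F1 z)).
have gPhi b : D b -> nash_germ Phi b.
  move=> Db; have Ob : Omega (A:=A) D (slice_embed (e K) b) by exists (e K), b.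
  have [V [h [oV Vb nVh hV]]] := nL _ Ob.
  apply: (@cauchy_riemann_nash_germ R _ (enum_rank finset.set0) (enum_rank K) V h D) => //.
  - by rewrite (inj_eq enum_rank_inj) eq_sym.
  - by rewrite -coords_slice_embed.
  - move=> z Dz; rewrite -coords_slice_embed // => Vz.
    rewrite hV //; last by exists (e K), z.
    by rewrite indF // componentD component_mul_e.
  - by move=> z Dz; apply: cauchy_riemann_components.
have g1 := gPhi a Da; have g2 := nash_germ_conj (gPhi (conjc a) (cD Da)).
have PhiC z : D z -> conjc (Phi (conjc z)) =
   (component L (F1 z) - s * component M (F2 z)) +i* (component L (F2 z) + s * component M (F1 z)).
  move=> Dz; have [s1 s2] := stemF Dz; rewrite /Phi s1 s2 !componentN /=.
  by apply/eqP; rewrite eq_complex /=; apply/andP; split; apply/eqP; ring.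
split.
  apply: (nash_germ_ext Da _ (nash_germ_linear (1 / 2)%:C (1 / 2)%:C g1 g2)) => z Dz.
  rewrite PhiC // /Phi /component_pair; apply/eqP; rewrite eq_complex /=.
  by apply/andP; split; apply/eqP; field.
(* As s is a sign, i s / 2 is the inverse of -2 i s, so F_M is i s / 2 times the
   difference of Phi and its reflection. *)
apply: (nash_germ_ext Da _ (nash_germ_linear (Complex 0 (s / 2)) (Complex 0 (- s / 2)) g1 g2)) => z Dz.
rewrite PhiC // /Phi /component_pair -/M; apply/eqP; rewrite eq_complex /=.
have [s1|s1] : s = -1 \/ s = 1 by apply: ca_sigma_pm1.
  by rewrite s1; apply/andP; split; apply/eqP; field.
by rewrite s1; apply/andP; split; apply/eqP; field.
Qed.
End Stem.
End Determining.

(** * Splitting bases, systems of Cartan pairs, and the Nash number *)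

Section Splitting.
Local Open Scope complex_scope.
Variables (R : realType) (n : nat) (A : cartan_star_algebra R n).
Local Notation "x ** y" := (ca_mul x y) (at level 40, left associativity).
Local Notation e := (ca_e A).
Local Notation sg := (ca_sigma A).
Local Notation C := (Cplx R).
Implicit Types K H L : {set 'I_n}.

Lemma one_mul (x : A) : ca_one A ** x = x.
Proof.
apply: component_ext => L; rewrite /ca_one component_mul_e ca_sigma0l mul1r.
by rewrite symdiffC symdiff0.
Qed.

Section Reps.
Variables (K : {set 'I_n}) (k : 'I_n).
Hypothesis kK : k \in K.

Definition reps : {set {set 'I_n}} := [set H : {set 'I_n} | k \notin H]%SET.
(** Representatives of the sets modulo symmetric difference with [K]: those that avoid the point
    [k] of [K].  The empty set is put first, since a splitting basis begins with 1. *)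
Definition rep_seq : seq {set 'I_n} := finset.set0 :: enum (reps :\ finset.set0)%SET.
Definition rep (j : 'I_(uA A).+1) : {set 'I_n} := nth finset.set0 rep_seq j.

Lemma mem_rep_seq H : (H \in rep_seq) = (k \notin H).
Proof.
rewrite inE mem_enum !inE; case: eqP => [->|_] //=; by rewrite inE.
Qed.

Lemma uniq_rep_seq : uniq rep_seq.
Proof. by rewrite /= enum_uniq mem_enum !inE eqxx. Qed.

Lemma symdiff_rep H : (k \notin setsymdiff K H) = (k \in H).
Proof. by rewrite in_symdiff kK; case: (k \in H). Qed.

(** Symmetric difference with K exchanges the sets that contain k with those that avoid it, so the
    representatives make up half of the dimension of A. *)
Lemma size_rep_seq : size rep_seq = (uA A).+1.
Proof.
have sr : size rep_seq = #|reps|.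
  rewrite -(card_uniqP uniq_rep_seq); apply: eq_card => H.
  by rewrite mem_rep_seq inE.
have dimA : \dim (fullv : {vspace A}) = (#|reps| + #|reps|)%N.
  rewrite (vector.size_basis (ca_e_basis A : basis_of fullv (codom_tuple e))).
  rewrite -cardsT -(cardsID reps [set: {set 'I_n}]%SET) finset.setTI finset.setTD.
  congr (_ + _)%N; rewrite -(card_imset reps (can_inj (symdiffKK K))).
  apply: eq_card => H; rewrite !inE; apply/idP/imsetP => [kH|[G GR ->]].
    by exists (setsymdiff K H); [rewrite finset.in_set symdiff_rep; move: kH; rewrite negbK|rewrite symdiffKK].
  by move: GR; rewrite inE symdiff_rep.
have r0 : (0 < #|reps|)%N by apply/card_gt0P; exists finset.set0; rewrite !inE.
by rewrite sr /uA dimA addnn doubleK prednK.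
Qed.

Lemma rep_notin j : k \notin rep j.
Proof. by rewrite -mem_rep_seq mem_nth // size_rep_seq. Qed.

Lemma rep_inj : injective rep.
Proof.
move=> i j /eqP; rewrite /rep nth_uniq ?size_rep_seq ?uniq_rep_seq // => /eqP h.
exact: val_inj.
Qed.

Lemma rep_cover L : exists j, L = rep j \/ L = setsymdiff K (rep j).
Proof.
have find H : k \notin H -> exists j, H = rep j.
  rewrite -mem_rep_seq => h; have lt : (index H rep_seq < (uA A).+1)%N.
    by rewrite -size_rep_seq index_mem.
  by exists (Ordinal lt); rewrite /rep nth_index.
have [kL|kL] := boolP (k \in L); last by have [j ->] := find _ kL; exists j; left.
have [|j ej] := find (setsymdiff K L); first by rewrite symdiff_rep.
by exists j; right; rewrite -ej symdiffKK.
Qed.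

Lemma component_slice_mul (w : R[i]) H L :
  component L (slice_embed (e K) w ** e H) =
  complex.Re w * (H == L)%:R + complex.Im w * (sg K H * (setsymdiff K H == L)%:R).
Proof.
by rewrite /slice_embed ca_mulDl !ca_mulZl one_mul ca_mul_e componentD !componentZ !component_e.
Qed.

(** A coordinate alpha + beta e_K at the representative H contributes alpha to e_H and
    beta, up to sign, to e_K e_H; these basis vectors are pairwise distinct. *)
Lemma component_splitting (w : 'I_(uA A).+1 -> R[i]) (j : 'I_(uA A).+1) :
  component (rep j) (\sum_(i < (uA A).+1) slice_embed (e K) (w i) ** e (rep i)) = complex.Re (w j) /\
  component (setsymdiff K (rep j)) (\sum_(i < (uA A).+1) slice_embed (e K) (w i) ** e (rep i)) =
    sg K (rep j) * complex.Im (w j).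
Proof.
have ne i l : (setsymdiff K (rep i) == rep l) = false.
  apply/negbTE; apply: contraNneq (rep_notin i) => h.
  by rewrite -symdiff_rep h rep_notin.
split; rewrite component_sum (bigD1 j) //= big1 ?addr0 => [|i ij].
- by rewrite component_slice_mul ne eqxx !mulr0 mulr1 addr0.
- by rewrite component_slice_mul ne (inj_eq rep_inj) (negbTE ij) !mulr0 addr0.
- by rewrite component_slice_mul eqxx eq_sym ne mulr0 add0r mulr1 mulrC.
rewrite component_slice_mul eq_sym ne mulr0 add0r (inj_eq (can_inj (symdiffKK K))).
by rewrite (inj_eq rep_inj) (negbTE ij) !mulr0.
Qed.

Definition splitting_coord (x : A) (j : 'I_(uA A).+1) : R[i] :=
  component (rep j) x +i* (sg K (rep j) * component (setsymdiff K (rep j)) x).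

Lemma sigma_sqr H L : sg H L * sg H L = 1.
Proof. by case: (ca_sigma_pm1 A H L) => ->; rewrite ?mulrNN mulr1. Qed.

Lemma splitting_coordE (x : A) :
  x = \sum_(j < (uA A).+1) slice_embed (e K) (splitting_coord x j) ** e (rep j).
Proof.
apply: component_ext => L; have [j [->|->]] := rep_cover L.
  by rewrite (component_splitting (splitting_coord x) j).1.
by rewrite (component_splitting (splitting_coord x) j).2 /= mulrA sigma_sqr mul1r.
Qed.

Lemma splitting_basis_rep : splitting_basis (e K) (fun j => e (rep j)).
Proof.
split=> [//|x]; exists [ffun j => splitting_coord x j]; split.
  by rewrite {1}(splitting_coordE x); apply: eq_bigr => j _; rewrite ffunE.
move=> w xw; apply/ffunP => j; rewrite ffunE /splitting_coord.
have [h1 h2] := component_splitting w j; rewrite -xw in h1 h2.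
by rewrite h1 h2 mulrA sigma_sqr mul1r; case: (w j).
Qed.
End Reps.

(** Each pair {H, K-translate of H} met by [T] has both of its functions F_H controlled by one
    component of f; the coordinates of the stem function in the splitting basis attached to
    e_K are, up to signs, these functions. *)
Lemma nash_determining_of_cover (T : {set {set 'I_n}}) :
  (forall H, exists2 K, imaginary_units (e K) & H \in T \/ setsymdiff K H \in T) ->
  nash_determining A T.
Proof.
move=> cov D f [D0 oD cD] [F1 [F2 [st ind C1F CRF]]] nT.
have germ H a : D a -> nash_germ (component_pair F1 F2 H) a.
  move=> Da; have [K uK [HT|HT]] := cov H.
    exact: (nash_component_germs oD cD st ind C1F CRF uK (nT _ HT) Da).1.
  have := (nash_component_germs oD cD st ind C1F CRF uK (nT _ HT) Da).2.
  by rewrite symdiffKK.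
exists F1, F2; split=> //.
have [K uK _] := cov finset.set0.
have /set0Pn[k kK] := unit_neq0 uK.
exists (e K), (fun j => e (rep k j)), (fun j z => splitting_coord K k (F1 z) j),
  (fun j z => splitting_coord K k (F2 z) j); split=> //.
- exact: splitting_basis_rep.
- by move=> z _; split; apply: splitting_coordE.
- by move=> j; apply: nash_germ_complex_nash => // a Da; apply: germ.
move=> j; apply: nash_germ_complex_nash => // a Da.
have g := germ (setsymdiff K (rep k j)) a Da.
apply: (nash_germ_ext oD Da _ (nash_germ_linear (sg K (rep k j))%:C 0 g g)) => z Dz.
apply/eqP; rewrite eq_complex /= !(mul0r, subr0, addr0, mulr0); by rewrite !eqxx.
Qed.

Lemma minimum_exists (S : set nat) : (exists k, S k) -> exists m, is_minimum S m.
Proof.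
move=> [k Sk]; have ex : exists k, `[< S k >] by exists k; apply/asboolP.
exists (ex_minn ex); case: ex_minnP => m /asboolP Sm mm; split=> // l Sl.
by apply: mm; apply/asboolP.
Qed.

(** Any point k of K splits the sets into those that contain k and those that avoid it, and
    symmetric difference with K pairs the two classes. *)
Lemma SCP_exists K : imaginary_units (e K) -> exists S, is_SCP A S.
Proof.
move=> uK; have /set0Pn[k kK] := unit_neq0 uK.
pose S := [set (L, setsymdiff K L) | L in [set L : {set 'I_n} | k \in L]]%SET.
have S1 : ([set p.1 | p in S] = [set L : {set 'I_n} | k \in L])%SET.
  apply/setP => L; rewrite inE; apply/imsetP/idP => [[p /imsetP[L' kL ->] ->]|kL].
    by move: kL; rewrite inE.
  by exists (L, setsymdiff K L) => //; apply/imsetP; exists L; rewrite ?inE.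
have S2 : ([set p.2 | p in S] = [set L : {set 'I_n} | k \notin L])%SET.
  apply/setP => L; rewrite inE; apply/imsetP/idP => [[p /imsetP[L' kL ->] ->]|kL].
    by move: kL; rewrite inE /= (symdiff_rep kK).
  exists (setsymdiff K L, L) => //; apply/imsetP; exists (setsymdiff K L).
    by rewrite inE -[k \in _]negbK (symdiff_rep kK).
  by rewrite symdiffKK.
exists S; split; rewrite ?S1 ?S2.
- move=> p /imsetP[L _ ->]; apply: (unit_symdiff uK).
  by rewrite /= symdiffC -symdiffA symdiffK symdiff0.
- by apply/setP => L; rewrite !inE orbN.
- by apply/setP => L; rewrite !inE andbN.
Qed.

(** In a Cartan pair (e_L, e_M) each of L and M is the translate of the other by their symmetric
    difference, whose basis vector is an imaginary unit. *)
Lemma SCP_determining S : is_SCP A S ->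
  nash_determining A [set p.1 | p in S]%SET /\ nash_determining A [set p.2 | p in S]%SET.
Proof.
move=> [Sp Sc _].
have cov H : exists2 p, p \in S & H = p.1 \/ H = p.2.
  have : H \in [set: {set 'I_n}]%SET by rewrite inE.
  by rewrite -Sc inE => /orP[] /imsetP[p pS ->]; exists p; auto.
split; apply: nash_determining_of_cover => H; have [p pS Hp] := cov H;
  exists (setsymdiff p.1 p.2); try (by apply: (symdiff_unit (Sp _ pS))).
  case: Hp => ->; [left|right; rewrite -symdiffA symdiffK symdiff0]; exact: imset_f.
case: Hp => ->; [right; rewrite symdiffC symdiffKK|left]; exact: imset_f.
Qed.
End Splitting.

Theorem theorem1p11 (R : realType) (n : nat) (hn : (1 <= n)%N)
    (A : cartan_star_algebra R n) (hA : alternative A)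
    (hS : exists J : A, imaginary_units J) :
  exists N C : nat,
    [/\ is_nash_number A N, is_cartan_number A C & (N <= C)%N].
Proof.
have [J uJ] := hS; have [K uK] := exists_basis_unit uJ.
have [S0 hS0] := SCP_exists uK.
have [C hC] : exists C, is_cartan_number A C.
  by apply: minimum_exists; eexists; exists S0.
have [[S hS' eC] _] := hC; have [d1 d2] := SCP_determining hS'.
have [T dT eT] : exists2 T, nash_determining A T & C = #|T|.
  rewrite eC /minn; case: ifP => _; first by exists [set p.1 | p in S]%SET.
  by exists [set p.2 | p in S]%SET.
have [N hN] : exists N, is_nash_number A N.
  by apply: minimum_exists; exists C; exists T.
by exists N, C; split=> //; apply: hN.2; exists T.
Qed.
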